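(* Let $\Phi:\mathbb{S}^1\to\mathbb{S}^1$ be a $C^2$ expanding circle map with absolutely continuous invariant probability measure $\rho\lambda$. For all positive integers $n$, there is a bi-Lipschitz embedding $F:B^n\to(\mathscr{P}(\mathbb{S}^1),\mathrm{W})$ mapping $0$ to $\rho\lambda$ such that $$\mathrm{W}\big(\Phi_\#(F(a)),F(a)\big)=o(|a|)\qquad\text{as } a\to 0.$$ As a consequence, for all $\varepsilon>0$ and all integers $K$ there is a radius $r>0$ such that for all $k\leqslant K$ and all $a\in B^n(0,r)$ the following holds: $$\mathrm{W}\big(\Phi_\#^k(F(a)),F(a)\big)\leqslant\varepsilon|a|.$$
   Context: $\mathbb{S}^1=\mathbb{R}/\mathbb{Z}$, $\lambda$ is the Lebesgue probability measure, $\mathscr{P}(\mathbb{S}^1)$ is the set of Borel probability measures on $\mathbb{S}^1$, $\Phi_\#$ is push-forward of measures and $\Phi_\#^k$ its $k$-th iterate ($k$ a nonnegative integer). A $C^2$ map $\Phi:\mathbb{S}^1\to\mathbb{S}^1$ is expanding if $|\Phi'|>1$ everywhere; such a map has a unique absolutely continuous invariant probability measure $\rho\lambda$, whose density $\rho$ is positive and $C^1$ (known facts). $\mathrm{W}$ is the quadratic Wasserstein metric: $\mathrm{W}(\mu,\nu)=\left(\inf_\Pi\int|x-y|^2\,\Pi(dx\,dy)\right)^{1/2}$, infimum over probability measures $\Pi$ on $\mathbb{S}^1\times\mathbb{S}^1$ with marginals $\mu,\nu$. $B^n$ is the unit Euclidean ball of $\mathbb{R}^n$ centered at $0$, $B^n(0,r)$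 the ball of radius $r$ centered at $0$, and $|a|$ the Euclidean norm. *)

(* Defs.v *)
From HB Require Import structures.
From mathcomp Require Import all_boot all_order all_algebra.
From mathcomp Require Import generic_quotient.
From mathcomp Require Import all_classical all_reals all_analysis.

Set Implicit Arguments.
Unset Strict Implicit.
Unset Printing Implicit Defensive.

Import Order.TTheory GRing.Theory Num.Theory.
Import numFieldNormedType.Exports.

Local Open Scope classical_set_scope.
Local Open Scope ring_scope.
Local Open Scope quotient_scope.

Section Circle.
Variable R : realType.

Definition eqmod1 : rel R := fun s t => s - t \is a Num.int.

Lemma eqmod1_refl : reflexive eqmod1.
Proof. by move=> s; rewrite /eqmod1 subrr rpred0. Qed.

Lemma eqmod1_sym : symmetric eqmod1.
Proof. by move=> s t; rewrite /eqmod1 -rpredN opprB. Qed.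

Lemma eqmod1_trans : transitive eqmod1.
Proof.
by move=> t s u st tu; rewrite /eqmod1 -(subrKA t); exact: rpredD.
Qed.

Definition eqmod1_equiv :=
  EquivRel eqmod1 eqmod1_refl eqmod1_sym eqmod1_trans.

(* R/Z, with the quotient topology and its Borel sigma-algebra. *)
Definition circle : Type := {eq_quot eqmod1_equiv}.

HB.instance Definition _ := Quotient.on circle.
HB.instance Definition _ := Topological.copy circle (quotient_topology circle).
HB.instance Definition _ := isPointed.Build circle (\pi_circle (0 : R)).
HB.instance Definition _ :=
  Measurable.copy circle (g_sigma_algebraType (@open circle)).

Definition circle_pi (s : R) : circle := \pi_circle s.

Lemma circle_pi_eq (s t : R) :
  circle_pi s = circle_pi t <-> s - t \is a Num.int.
Proof.
split; first by move=> /eqquotP.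
by move=> st; apply/eqquotP.
Qed.

Lemma circle_pi_continuous : continuous circle_pi.
Proof. exact: (@pi_continuous R circle). Qed.

Lemma preimage_open_measurable (d : measure_display) (T : measurableType d)
    (f : T -> circle) :
  (forall U, open U -> measurable (f @^-1` U)) -> measurable_fun setT f.
Proof.
move=> mf; apply: (@measurability _ _ _ _ _ _ (@open circle)) => //.
by move=> _ [U oU <-]; rewrite setTI; exact: mf.
Qed.

Lemma circle_pi_measurable : measurable_fun setT circle_pi.
Proof.
apply: preimage_open_measurable => U oU.
apply: measurable_realfun.open_measurable.
by move/continuousP : circle_pi_continuous; exact.
Qed.

Definition circle_pi_mfun : {mfun measurableTypeR R >-> circle} :=
  HB.pack circle_pi
    (@isMeasurableFun.Build _ _ (measurableTypeR R) circle
       circle_pi circle_pi_measurable).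

(* The image of the Lebesgue measure of [0, 1]. *)
Definition circle_lebesgue : probability circle R :=
  distribution (uniform_prob (@ltr01 R)) circle_pi_mfun.

Definition circle_dist (x y : circle) : R :=
  inf [set `|s - t| | s in [set s | circle_pi s = x]
                    & t in [set t | circle_pi t = y]].

(* Every continuous map of the circle has a continuous lift, unique up to an
   integer constant: the map is C^2 iff such a lift f is, and |f'(s)| is then
   the absolute value of the derivative of the map at circle_pi s. *)
Definition is_lift (f : R -> R) (Phi : circle -> circle) :=
  forall s, circle_pi (f s) = Phi (circle_pi s).

Definition is_C2 (f : R -> R) :=
  [/\ forall s, derivable f s 1, forall s, derivable (derive1 f) s 1
    & continuous (derive1 (derive1 f))].

Definition C2_expanding (Phi : circle -> circle) :=
  exists f : R -> R, [/\ is_lift f Phi, is_C2 f & forall s, 1 < `|derive1 f s|].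

Record expanding_map := ExpandingMap {
  expanding_fun :> circle -> circle ;
  expanding_funP : C2_expanding expanding_fun }.

Lemma expanding_continuous (Phi : expanding_map) : continuous Phi.
Proof.
have [f [fPhi [df _ _] _]] := expanding_funP Phi.
apply/(@quotient_continuous R circle).
rewrite (_ : _ \o _ = circle_pi \o f); last first.
  by apply/funext => s; rewrite /= fPhi.
move=> s; apply: continuous_comp; last exact: circle_pi_continuous.
by apply: differentiable_continuous; apply/derivable1_diffP.
Qed.

Lemma expanding_measurable (Phi : expanding_map) : measurable_fun setT Phi.
Proof.
apply: preimage_open_measurable => U oU; apply: sub_sigma_algebra.
by move/continuousP : (@expanding_continuous Phi); exact.
Qed.

Definition expanding_mfun (Phi : expanding_map) : {mfun circle >-> circle} :=
  HB.pack (expanding_fun Phi)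
    (@isMeasurableFun.Build _ _ circle circle
       (expanding_fun Phi) (expanding_measurable Phi)).

Definition push (Phi : expanding_map) (mu : probability circle R)
  : probability circle R := distribution mu (expanding_mfun Phi).

Definition coupling (mu nu : probability circle R)
    : set (probability (circle * circle)%type R) :=
  [set Pi | forall A : set circle, measurable A ->
     Pi (A `*` setT) = mu A /\ Pi (setT `*` A) = nu A].

(* The infimum is finite, hence harmless under fine: the product of mu and nu
   is a coupling, and circle_dist is bounded by 1/2. *)
Definition W (mu nu : probability circle R) : R :=
  Num.sqrt (fine (ereal_inf
    [set (\int[Pi]_z (circle_dist z.1 z.2 ^+ 2)%:E)%E | Pi in coupling mu nu])).

(* The library norm of 'rV[R]_n is the sup norm. *)
Definition enorm (n : nat) (a : 'rV[R]_n) : R :=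
  Num.sqrt (\sum_(i < n) a ord0 i ^+ 2).

Definition eball (n : nat) (r : R) : set 'rV[R]_n := [set a | enorm a <= r].

Definition bilipschitz_on (n : nat) (A : set 'rV[R]_n)
    (F : 'rV[R]_n -> probability circle R) :=
  exists2 L : R, 0 < L & forall a b, A a -> A b ->
    L^-1 * enorm (a - b) <= W (F a) (F b) <= L * enorm (a - b).

End Circle.

Arguments eball {R} n r.

(* Main.v *)
(* Write sg * f for the increasing lift of the map, of degree d > 1, and describe
   an atomless measure by a lift H of its distribution function. Push-forward by
   the map acts on H by the linear transfer operator L, which sums the values of H
   over the d inverse branches. If h sums to 0 over the preimages of every point,
   then L h = 0, while L (u o f) = sg d u for u 1-periodic; hence the Weierstrass
   type sums sum_k (sg d)^-k h o f^k are fixed by L.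

   These sums are not Lipschitz, so G - sum_i a_i sum_k (sg d)^-k h_i o f^k need
   not be monotone, where G is the distribution function of the invariant
   measure. We therefore cut off the coefficient a_i in the k-th term at height
   (2 D)^-k, where D bounds f'. The total perturbation becomes uniformly Lipschitz
   with a small constant, and it is monotone as soon as G has slopes bounded below.
   L shifts the cut-offs by one index, which changes the sum by o(|a|) in sup norm,
   and the quantile coupling bounds W by this sup norm divided by the slope.

   The terms with k > 0 take the same value at the two ends of an inverse image of a
   full turn, and the term k = 0 is not cut off. So the masses of such arcs depend
   linearly on a, which gives the lower Lipschitz bound.

   That the slopes of G are bounded below follows from absolute continuity alone:
   up to a small error in total variation the density is constant at small scales,
   and f^k spreads a small arc over the circle with bounded distortion. *)
Require Import Defs.
From HB Require Import structures.
From mathcomp Require Import all_boot all_order all_algebra.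
From mathcomp Require Import all_classical all_reals all_analysis.
From mathcomp Require Import giry measurable_realfun.
From mathcomp Require Import zify ring lra.

Set Implicit Arguments.
Unset Strict Implicit.
Unset Printing Implicit Defensive.

Import Order.TTheory GRing.Theory Num.Theory.
Import numFieldNormedType.Exports.

Local Open Scope classical_set_scope.
Local Open Scope ring_scope.

(** * Arcs and representatives on the circle *)

Section CircleBasics.
Variable R : realType.
Implicit Types (s t u : R) (x y : circle R).

(** Why cut off: the weight [d^-k] competes with the Lipschitz constant of [f^k], bounded only by
    [D^k] with D >= d, so a small parameter does not make the series small in the Lipschitz sense.
    The height [(2 D)^-k] turns [D^k] into [2^-k]. The cut-off moreover falls back to 0 instead of
    saturating: for each a only finitely many terms survive, so every series is a finite sum whose
    length depends on a.

    Why o(|a|): when |a| is at most the height of index M + j, shifting the cut-offs by j changes no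
    term of index at most M, and the remaining terms add up to O(2^-M |a|). A bound K on the shift
    thus treats all iterates up to K at once.

    Why a family of arcs in the lower bound: a mass defect of one single arc does not bound W, since
    mass may cross an endpoint at negligible cost. The defect has to persist while the endpoints
    sweep an interval. Tents with disjoint supports, one per coordinate, provide such an interval on
    which the defect sees only [a_i]. *)

Definition fracp t : R := t - (Num.floor t)%:~R.

Lemma fracp_ge0 t : 0 <= fracp t.
Proof. by rewrite subr_ge0 ge_floor. Qed.

Lemma fracp_lt1 t : fracp t < 1.
Proof. by rewrite ltrBlDl; have := floorD1_gt t; rewrite intrD. Qed.

Lemma fracp_id t : 0 <= t < 1 -> fracp t = t.
Proof.
by move=> t01; rewrite /fracp (_ : Num.floor t = 0) ?subr0//; apply/floor_def.
Qed.

Lemma circle_piDz t (m : int) : circle_pi (t + m%:~R) = circle_pi t.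
Proof. by apply/circle_pi_eq; rewrite addrAC subrr add0r intr_int. Qed.

Lemma circle_piDn t (m : nat) : circle_pi (t + m%:R) = circle_pi t.
Proof. by rewrite -(circle_piDz t m). Qed.

Lemma circle_piD1 t : circle_pi (t + 1) = circle_pi t.
Proof. exact: (circle_piDn t 1). Qed.

Lemma circle_pi_eqz s t : circle_pi s = circle_pi t <-> exists m : int, s = t + m%:~R.
Proof.
rewrite circle_pi_eq; split.
  by case/intrP => m h; exists m; rewrite -h addrC subrK.
by case=> m ->; rewrite addrAC subrr add0r intr_int.
Qed.

Lemma circle_pi_fracp t : circle_pi (fracp t) = circle_pi t.
Proof. by rewrite /fracp -intrN circle_piDz. Qed.

Lemma circle_pi_surj x : exists s, circle_pi s = x.
Proof. by exists (repr x); rewrite /circle_pi reprK. Qed.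

Lemma circle_pi_inj01 s t : 0 <= s < 1 -> 0 <= t < 1 ->
  circle_pi s = circle_pi t -> s = t.
Proof.
move=> s01 t01 /circle_pi_eqz[m sE].
have : -1 < (m%:~R : R) < 1 by lra.
rewrite -[X in _ < _ < X]/((1%:Z)%:~R) -[X in X < _ < _]/((-1%:Z)%:~R) !ltr_int.
by case: m sE => [[|m]|[|m]]// -> _; rewrite addr0.
Qed.

(** The section of [circle_pi] with values in [0, 1). It is discontinuous but measurable, and it
    carries measures on the circle to the line. *)
Definition kappa x : R := fracp (repr x).

Lemma kappa_ge0 x : 0 <= kappa x. Proof. exact: fracp_ge0. Qed.
Lemma kappa_lt1 x : kappa x < 1. Proof. exact: fracp_lt1. Qed.

Lemma kappaK x : circle_pi (kappa x) = x.
Proof. by rewrite circle_pi_fracp /circle_pi reprK. Qed.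

Lemma kappa_pi t : kappa (circle_pi t) = fracp t.
Proof.
apply: circle_pi_inj01; rewrite ?kappa_ge0 ?kappa_lt1 ?fracp_ge0 ?fracp_lt1//.
by rewrite kappaK circle_pi_fracp.
Qed.

Definition carc s t : set (circle R) := @circle_pi R @` [set u | s <= u <= t].

Lemma carc_pi s t u : carc s t (circle_pi u) <-> exists m : int, s <= u + m%:~R <= t.
Proof.
split; first by case=> v /= vst /circle_pi_eqz[m vE]; exists m; rewrite -vE.
by case=> m umst; exists (u + m%:~R) => //; rewrite circle_piDz.
Qed.

Lemma carcDz s t (m : int) : carc (s + m%:~R) (t + m%:~R) = carc s t.
Proof.
apply/seteqP; split => x; have [u <-] := circle_pi_surj x => /carc_pi[k ukst];
  apply/carc_pi.
- by exists (k - m); rewrite intrB; lra.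
- by exists (k + m); rewrite intrD; lra.
Qed.

Lemma carcxx s : carc s s = [set circle_pi s].
Proof.
apply/seteqP; split => [x [u /= us <-]|x ->]; last by exists s => //=; lra.
by congr circle_pi; lra.
Qed.

Lemma open_circle_itv s t : open (@circle_pi R @` `]s, t[).
Proof.
have -> : open (@circle_pi R @` `]s, t[) = open (@circle_pi R @^-1` (@circle_pi R @` `]s, t[)).
  by [].
rewrite (_ : _ @^-1` _ =
    \bigcup_(m in [set: int]) `]s - m%:~R, t - m%:~R[%classic); last first.
  apply/seteqP; split => [u [v /=]|u [m _ /=]]; rewrite !in_itv/=.
    move=> vst /circle_pi_eqz[m vE]; exists m => //=; rewrite in_itv/=; lra.
  by move=> ust; exists (u + m%:~R); rewrite ?circle_piDz//= in_itv/=; lra.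
by apply: bigcup_open => m _; exact: itv_open.
Qed.

(** Each point of the circle has exactly one lift in [s, s + 1), so the lifts outside [s, t] fill
    []t, s + 1[]. This makes arcs complements of open sets. *)
Lemma carcC s t : s <= t < s + 1 -> carc s t = ~` (@circle_pi R @` `]t, s + 1[).
Proof.
move=> st; apply/seteqP; split => x.
  case=> u /= ust <- [v /=]; rewrite in_itv/= => vts /circle_pi_eqz[m vE].
  have : 0 < (m%:~R : R) < 1 by lra.
  rewrite -[X in _ < _ < X]/((1%:Z)%:~R) -[X in X < _ < _]/((0%:Z)%:~R) !ltr_int.
  by case: m {vE} => [[|m]|m].
have [u <-] := circle_pi_surj x => xN; apply/carc_pi.
exists (- Num.floor (u - s)); rewrite intrN.
have /andP[h1 h2] := floor_itv (u - s); rewrite intrD in h2.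
suff : ~ (t < u - (Num.floor (u - s))%:~R) by move/negP; rewrite -leNgt; lra.
move=> tu; apply: xN; exists (u - (Num.floor (u - s))%:~R).
  by rewrite /= in_itv/=; lra.
by rewrite -intrN circle_piDz.
Qed.

Lemma measurable_carc s t : s <= t < s + 1 -> measurable (carc s t).
Proof.
move=> st; rewrite carcC//; apply: measurableC; apply: sub_sigma_algebra.
exact: open_circle_itv.
Qed.

Lemma kappa_le_carc t : 0 <= t < 1 -> [set x | kappa x <= t] = carc 0 t.
Proof.
move=> t01; apply/seteqP; split => x /=.
  by move=> xt; exists (kappa x); rewrite ?kappaK//= kappa_ge0.
by case=> u /= ut <-; rewrite kappa_pi fracp_id//; lra.
Qed.

Lemma measurable_kappa_le t : measurable [set x | kappa x <= t].
Proof.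
have [t0|t0] := ltP t 0.
  rewrite (_ : [set _ | _] = set0)//; apply/seteqP; split => // x /=.
  by have := kappa_ge0 x; lra.
have [t1|t1] := ltP t 1; last first.
  rewrite (_ : [set _ | _] = setT)//; apply/seteqP; split => // x /= _.
  by have := kappa_lt1 x; lra.
by rewrite kappa_le_carc ?t0//; apply: measurable_carc; lra.
Qed.

Lemma measurable_kappa : measurable_fun setT (kappa : circle R -> measurableTypeR R).
Proof.
apply: (measurability (@RGenOInfty.G R)) => [|/= _ [_] [r] -> <-].
  exact: RGenOInfty.measurableE.
rewrite setTI (_ : _ @^-1` _ = ~` [set x | kappa x <= r]).
  by apply: measurableC; exact: measurable_kappa_le.
by apply/seteqP; split => x /=; rewrite in_itv/= andbT ltNge => /negP.
Qed.

End CircleBasics.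

Definition mfun_of (d1 d2 : measure_display) (T1 : measurableType d1)
    (T2 : measurableType d2) (f : T1 -> T2) (mf : measurable_fun setT f)
    : {mfun T1 >-> T2} :=
  HB.pack f (@isMeasurableFun.Build _ _ T1 T2 f mf).

(** * Lifts of increasing circle maps and their inverses *)

Section DegreeMaps.
Variable R : realType.
Implicit Types (p g : R -> R) (d : nat).

(** With d = 1 this also describes lifted distribution functions of atomless measures of full
    support, so inverse branches and quantile functions come from one inversion lemma. *)
Definition degmap p d :=
  [/\ continuous p, {mono p : s t / s <= t} & forall s, p (s + 1) = p s + d%:R].

Lemma homo_lt_mono_le p : {homo p : s t / s < t} -> {mono p : s t / s <= t}.
Proof. by move=> hp; exact: le_mono. Qed.

Lemma degmapDn p d s n : degmap p d -> p (s + n%:R) = p s + (n * d)%:R.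
Proof.
move=> [_ _ pD]; elim: n => [|n IH]; first by rewrite mul0n !addr0.
by rewrite -natr1 addrA pD IH mulSn natrD -addrA; congr (_ + _); rewrite addrC.
Qed.

Lemma degmapDz p d s (m : int) : degmap p d -> p (s + m%:~R) = p s + m%:~R * d%:R.
Proof.
move=> pd; case: m => n; first by rewrite (degmapDn _ _ pd) natrM.
have := degmapDn (s - n.+1%:R) n.+1 pd; rewrite subrK => ->.
by rewrite NegzE intrN mulNr natrM addrK.
Qed.

(** [g] sends the neighbourhood []p (g t - e), p (g t + e)[] of [t] into []g t - e, g t + e[]. *)
Lemma mono_surj_continuous p g : {mono p : s t / s <= t} -> {mono g : s t / s <= t} ->
  cancel g p -> continuous g.
Proof.
move=> pm gm gp t; have plt := leW_mono pm.
apply/cvgrPdist_lt => e e0; near=> u.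
have h1 : p (g t - e) < u.
  by near: u; apply: lt_nbhsr; rewrite -[ltRHS]gp plt ltrBlDr ltrDl.
have h2 : u < p (g t + e).
  by near: u; apply: lt_nbhsl; rewrite -[ltLHS]gp plt ltrDl.
have h3 : g t - e < g u by rewrite -plt gp.
have h4 : g u < g t + e by rewrite -plt gp.
by rewrite ltr_norml; apply/andP; split; lra.
Unshelve. all: by end_near. Qed.

Lemma degmap_inv p d : (0 < d)%N -> degmap p d ->
  exists g, [/\ cancel p g, cancel g p, {mono g : s t / s <= t}, continuous g
    & forall t (m : int), g (t + m%:~R * d%:R) = g t + m%:~R].
Proof.
move=> d0 pd; have [pc pm pD] := pd.
have surj v : exists s, p s = v.
  (* On [-n, n] the values run from p 0 - n d to p 0 + n d, which brackets v. *)
  pose n := (Num.truncn `|v - p 0|).+1.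
  have hn : `|v - p 0| < n%:R by rewrite truncnS_gt.
  have hd : (n%:R : R) <= (n * d)%:R by rewrite ler_nat leq_pmulr.
  have p1 := degmapDn 0 n pd; have p2 := degmapDn (- n%:R) n pd.
  rewrite add0r in p1; rewrite addNr in p2.
  have [|||s _ <-] := @IVT R p (- n%:R) n%:R v; last by exists s.
    - by rewrite -subr_ge0 opprK -natrD.
    - exact: continuous_subspaceT.
    - move: hn; rewrite ltr_norml => /andP[h1 h2].
      by rewrite ge_min le_max; apply/andP; split; apply/orP; [left|right]; lra.
have [g gp] := choice surj.
have pinj : injective p by exact: inc_inj.
have pg : cancel p g by move=> s; apply: pinj; rewrite gp.
have gm : {mono g : s t / s <= t} by move=> s t; rewrite -pm !gp.
exists g; split => //; first exact: mono_surj_continuous gm gp.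
by move=> t m; apply: pinj; rewrite gp (degmapDz _ _ pd) gp.
Qed.

End DegreeMaps.

(** * Atomless measures as lifted distribution functions *)

Section LiftedCdf.
Variable R : realType.
Implicit Types (s t u : R) (nu : probability (circle R) R) (G H : R -> R).

Lemma measure_setU_null (d : measure_display) (T : measurableType d)
    (nu : probability T R) (A B : set T) :
  measurable A -> measurable B -> nu (A `&` B) = 0%E ->
  nu (A `|` B) = (nu A + nu B)%E.
Proof.
move=> mA mB AB0; rewrite measureUfinl//.
  by rewrite [X in (_ - X)%E](_ : _ = 0%E)// sube0.
exact: (le_lt_trans (probability_le1 _ mA) (ltry _)).
Qed.

(* [H] is a distribution function of [nu] lifted to R, up to an additive
   constant; taking [s = t] shows that [nu] has no atoms. *)
Definition lcdf nu H :=
  forall s t, s <= t < s + 1 -> nu (carc s t) = (H t - H s)%:E.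

Lemma lcdf_shift nu H G (c : R) : (forall t, H t = G t + c) ->
  lcdf nu G -> lcdf nu H.
Proof. by move=> HG nuG s t st; rewrite nuG// !HG; congr EFin; lra. Qed.

Definition mass_below nu t : R := fine (nu [set x | kappa x <= t]).

Lemma mass_belowE nu t : 0 <= t < 1 -> (mass_below nu t)%:E = nu (carc 0 t).
Proof.
move=> t01; rewrite /mass_below kappa_le_carc// fineK//.
by rewrite fin_num_measure//; apply: measurable_carc; lra.
Qed.

Lemma measurable_circle1 (x : circle R) : measurable [set x].
Proof.
by have [s <-] := circle_pi_surj x; rewrite -carcxx; apply: measurable_carc; lra.
Qed.

Lemma atomless_sub2 nu (A : set (circle R)) x y : (forall x, nu [set x] = 0%E) ->
  measurable A -> A `<=` [set x; y] -> nu A = 0%E.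
Proof.
move=> nu0 mA Axy; apply/eqP; rewrite -measure_le0.
have mx := measurable_circle1 x; have my := measurable_circle1 y.
apply: (@le_trans _ _ (nu ([set x] `|` [set y]))).
  by apply: le_measure => //; rewrite inE//; exact: measurableU.
by rewrite -[leRHS](adde0 0%E) -{1}(nu0 x) -(nu0 y); exact: measureU2.
Qed.

Lemma atomless_lcdf01 nu s t : (forall x, nu [set x] = 0%E) ->
  0 <= s <= t -> t < 1 -> nu (carc s t) = (mass_below nu t - mass_below nu s)%:E.
Proof.
move=> nu0 st t1.
have m1 : measurable (carc 0 s) by apply: measurable_carc; lra.
have m2 : measurable (carc s t) by apply: measurable_carc; lra.
have tE : carc 0 t = carc 0 s `|` carc s t.
  apply/seteqP; split => [x [u /= ut <-]|x [] [u /= ut <-]]; last 2 first.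
  - by exists u => //=; lra.
  - by exists u => //=; lra.
  by have [us|us] := leP u s; [left|right]; exists u => //=; lra.
have : nu (carc 0 t) = (nu (carc 0 s) + nu (carc s t))%E.
  rewrite tE measure_setU_null//; apply: (@atomless_sub2 _ _ (circle_pi s) (circle_pi s)) => //.
    exact: measurableI.
  move=> x [[u /= us <-] [v /= vst /circle_pi_inj01 uv]]; left; congr circle_pi.
  have := uv _ _; lra.
rewrite -!mass_belowE; [|lra|lra].
move/eqP; rewrite -(fineK (fin_num_measure nu _ m2)) -EFinD eqe => /eqP ->.
by congr EFin; lra.
Qed.

Lemma atomless_lcdf nu : (forall x, nu [set x] = 0%E) ->
  lcdf nu (fun t => mass_below nu (fracp t) + (Num.floor t)%:~R).
Proof.
move=> nu0.
(* An arc that crosses an integer is, up to its two endpoints, the complement of an arc inside [0,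
   1). *)
have wrap s t : 0 <= s < 1 -> 0 <= t < s ->
    nu (carc s (t + 1)) = (1 - (mass_below nu s - mass_below nu t))%:E.
  move=> s1 ts; have m1 : measurable (carc s (t + 1)) by apply: measurable_carc; lra.
  have m2 : measurable (carc t s) by apply: measurable_carc; lra.
  have : nu setT = (nu (carc s (t + 1)) + nu (carc t s))%E.
    rewrite -measure_setU_null//.
      congr (nu _); apply/seteqP; split => // x _.
      have [x1 x2] := (kappa_ge0 x, kappa_lt1 x).
      have [xs|xs] := leP s (kappa x).
        by left; exists (kappa x); rewrite ?kappaK//=; lra.
      have [tx|tx] := leP t (kappa x).
        by right; exists (kappa x); rewrite ?kappaK//=; lra.
      by left; exists (kappa x + 1); rewrite ?circle_piD1 ?kappaK//=; lra.
    apply: (@atomless_sub2 _ _ (circle_pi s) (circle_pi t)) => //.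
      exact: measurableI.
    move=> x [[u /= us <-] [v /= vst]].
    have [u1|u1] := ltP u 1.
      move=> /circle_pi_inj01 uv; left; congr circle_pi.
      have := uv _ _; lra.
    rewrite -[u](subrK 1) circle_piD1.
    move=> /circle_pi_inj01 uv; right; congr circle_pi.
    have := uv _ _; lra.
  rewrite (@atomless_lcdf01 nu t s)//; [|lra|lra].
  rewrite probability_setT -(fineK (fin_num_measure nu _ m1)) -EFinD => /eqP.
  by rewrite eqe => /eqP; move: (fine _) => w ->; congr EFin; lra.
move=> s t st; set m := Num.floor s.
have s01 := conj (fracp_ge0 s) (fracp_lt1 s).
have sE : s = fracp s + m%:~R by rewrite subrK.
have [tm|tm] := ltP (t - m%:~R) 1.
  have tE : t = fracp t + m%:~R.
    rewrite /fracp (_ : Num.floor t = m) ?subrK//; apply: floor_def.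
    by rewrite intrD; lra.
  have -> : Num.floor t = m by apply: floor_def; rewrite intrD; lra.
  rewrite {1}sE {1}tE carcDz atomless_lcdf01//; [|lra|lra].
  by congr EFin; lra.
have tf : Num.floor t = m + 1 by apply: floor_def; rewrite !intrD; lra.
have tE : t = fracp t + 1 + m%:~R by rewrite /fracp tf intrD; lra.
rewrite tf intrD {1}sE {1}tE carcDz wrap//; [|lra|]; last by have := fracp_ge0 t; lra.
by congr EFin; lra.
Qed.

Lemma lcdf_atomless nu G x : lcdf nu G -> nu [set x] = 0%E.
Proof.
move=> nuG; have [s <-] := circle_pi_surj x.
by rewrite -carcxx nuG ?subrr//; lra.
Qed.

Lemma lcdf_nondecreasing nu G s t : lcdf nu G -> s <= t < s + 1 -> G s <= G t.
Proof. by move=> nuG st; rewrite -subr_ge0 -lee_fin -nuG. Qed.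

(** [lcdf] only speaks of arcs shorter than a turn, so the circle is cut into two half turns that
    meet in two null points. *)
Lemma lcdfD1 nu G s : lcdf nu G -> G (s + 1) = G s + 1.
Proof.
move=> nuG; have h0 := nuG s (s + 2^-1); have h1 := nuG (s + 2^-1) (s + 1).
have m1 : measurable (carc s (s + 2^-1)) by apply: measurable_carc; lra.
have m2 : measurable (carc (s + 2^-1) (s + 1)) by apply: measurable_carc; lra.
have : nu setT = (nu (carc s (s + 2^-1)) + nu (carc (s + 2^-1) (s + 1)))%E.
  rewrite -measure_setU_null//.
    congr (nu _); apply/seteqP; split => // x _.
    have [u <-] := circle_pi_surj x; have := floor_itv (u - s); rewrite intrD => us.
    have [uh|uh] := leP (u - (Num.floor (u - s))%:~R) (s + 2^-1); [left|right];
      by exists (u - (Num.floor (u - s))%:~R); rewrite -?intrN ?circle_piDz//= intrN; lra.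
  apply: (@atomless_sub2 _ _ (circle_pi s) (circle_pi (s + 2^-1))) => //.
  - by move=> x; exact: lcdf_atomless nuG.
  - exact: measurableI.
  move=> x [[u /= us <-] [v /= vs /circle_pi_eqz[m vE]]].
  have : -1 < (m%:~R : R) < 2 by lra.
  rewrite -[X in _ < _ < X]/((2%:Z)%:~R) -[X in X < _ < _]/((-1%:Z)%:~R) !ltr_int => m02.
  have {m02}[m0|m0] : m = 0 \/ m = 1 by lia.
    by right; congr circle_pi; rewrite m0 in vE; lra.
  by left; congr circle_pi; rewrite m0 in vE; lra.
rewrite probability_setT h0 ?h1; [|lra|lra].
by rewrite -EFinD => /eqP; rewrite eqe => /eqP; lra.
Qed.

(** The masses of arcs shrinking to a point tend to the mass of that point, which is 0; monotonicity
    then squeezes [G] around [t]. *)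
Lemma lcdf_continuous nu G : lcdf nu G -> continuous G.
Proof.
move=> nuG t; pose h n : R := n.+3%:R^-1.
have h0 n : 0 < h n < 2^-1.
  by rewrite invr_gt0 ltr0n/= ltf_pV2 ?posrE ?ltr0n// ltr_nat.
pose A n := carc (t - h n) (t + h n).
have mA n : measurable (A n) by apply: measurable_carc; have := h0 n; lra.
have AE : \bigcap_n A n = [set circle_pi t].
  apply/seteqP; split => [x Ax|x -> n _]; last first.
    by exists t => //=; have := h0 n; lra.
  have [v /= vt xE] := Ax 0%N I; rewrite -xE; congr circle_pi.
  have h00 := h0 0%N.
  apply/eqP; rewrite eq_sym -subr_eq0 -normr_le0; apply/ler_addgt0Pl => e e0.
  rewrite addr0; pose n := Num.truncn e^-1.
  have hn : h n < e.
    rewrite /h invf_plt ?posrE ?ltr0n//; apply: (lt_trans (truncnS_gt _)).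
    by rewrite ltr_nat.
  have [w /= wt] := Ax n I; rewrite -xE => /circle_pi_eqz[m wE].
  have hn0 := h0 n.
  have : -1 < (m%:~R : R) < 1 by lra.
  rewrite -[X in _ < _ < X]/((1%:Z)%:~R) -[X in X < _ < _]/((-1%:Z)%:~R) !ltr_int.
  case: m wE => [[|m]|[|m]]// + _; rewrite addr0 => ?; subst w.
  by rewrite ler_norml; lra.
have : nu \o A @ \oo --> 0%E.
  rewrite -(lcdf_atomless (circle_pi t) nuG) -AE; apply: nonincreasing_cvg_mu => //.
  - exact: (le_lt_trans (probability_le1 _ (mA _)) (ltry _)).
  - by rewrite AE; exact: measurable_circle1.
  - move=> m n mn; apply/subsetPset => x [u /= ut <-]; exists u => //=.
    have : h n <= h m by rewrite lef_pV2 ?posrE ?ltr0n// ler_nat.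
    lra.
move=> cvA; apply/cvgrPdist_lt => e e0.
have [n ne] : exists n, G (t + h n) - G (t - h n) < e.
  have /fine_cvgP[_ /cvgrPdist_lt/(_ e e0)[N _ /(_ N (leqnn N))/=]] := cvA.
  rewrite sub0r normrN nuG; last by have := h0 N; lra.
  by move=> hN; exists N; apply: le_lt_trans hN; exact: ler_norm.
have hn := h0 n; near=> u.
have tu : `|t - u| < h n by near: u; apply: cvgr_dist_lt => //; lra.
have {tu}[tu1 tu2] : t - h n < u /\ u < t + h n.
  by move: tu; rewrite ltr_norml => /andP[? ?]; split; lra.
have g1 : G (t - h n) <= G u by apply: lcdf_nondecreasing nuG _; lra.
have g2 : G u <= G (t + h n) by apply: lcdf_nondecreasing nuG _; lra.
have g3 : G (t - h n) <= G t by apply: lcdf_nondecreasing nuG _; lra.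
have g4 : G t <= G (t + h n) by apply: lcdf_nondecreasing nuG _; lra.
by rewrite ltr_norml; apply/andP; split; lra.
Unshelve. all: by end_near. Qed.

(** Carried to the line by [kappa], both measures agree on the rays []r, +oo[], which are stable
    under intersection and generate the Borel sets. Every Borel set A of the circle is the
    [kappa]-preimage of its own preimage under [circle_pi]. *)
Lemma lcdf_unique nu nu' G : lcdf nu G -> lcdf nu' G ->
  forall A, measurable A -> nu A = nu' A.
Proof.
move=> nuG nu'G A mA.
have ray r : nu [set x | kappa x <= r] = nu' [set x | kappa x <= r].
  have [r0|r0] := ltP r 0.
    rewrite (_ : [set _ | _] = set0) ?measure0//; apply/seteqP; split => // x /=.
    by have := kappa_ge0 x; lra.
  have [r1|r1] := ltP r 1; last first.
    rewrite (_ : [set _ | _] = setT) ?probability_setT//.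
    by apply/seteqP; split => // x /= _; have := kappa_lt1 x; lra.
  by rewrite kappa_le_carc ?r0// nuG ?nu'G//; lra.
have E (B : set (measurableTypeR R)) : measurable B -> nu (@kappa R @^-1` B) = nu' (@kappa R @^-1` B).
  have mk := @measurable_kappa R.
  move=> mB.
  apply: (@measure_unique _ R (measurableTypeR R) (@RGenOInfty.G R)
    (fun k => `]- k%:R, +oo[%classic) _ _ _ _
    (distribution nu (mfun_of mk)) (distribution nu' (mfun_of mk))) => //.
  - exact: RGenOInfty.measurableE.
  - move=> _ _ [a ->] [b ->]; exists (Num.max a b).
    apply/seteqP; split => u /=; rewrite !in_itv/= !andbT gt_max; first by case=> -> ->.
    by move/andP.
  - by move=> i; exists (- i%:R).
  - apply/seteqP; split => // u _; exists (Num.truncn `|u|).+1 => //=.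
    rewrite in_itv/= andbT; have := truncnS_gt `|u|.
    by rewrite ltr_norml => /andP[].
  - move=> _ [r ->]; rewrite /= /distribution /pushforward /=.
    have -> : @kappa R @^-1` `]r, +oo[ = ~` [set x | kappa x <= r].
      by apply/seteqP; split => x /=; rewrite in_itv/= andbT ltNge => /negP.
    by rewrite !probability_setC ?ray//; exact: measurable_kappa_le.
  - move=> k; rewrite /= /distribution /pushforward /=; apply: (le_lt_trans (probability_le1 _ _) (ltry _)).
    by rewrite -[X in measurable X]setTI; apply: mk.
have -> : A = @kappa R @^-1` (@circle_pi R @^-1` A).
  by apply/seteqP; split => x /=; rewrite kappaK.
by apply: E; rewrite -[X in measurable X]setTI; apply: circle_pi_measurable.
Qed.

End LiftedCdf.

(** * Lebesgue measure on the circle *)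

Section CircleLebesgue.
Variable R : realType.

Lemma uniform_prob01E (A : set (measurableTypeR R)) : measurable A ->
  uniform_prob (@ltr01 R) A = lebesgue_measure (A `&` `[0, 1]).
Proof.
move=> mA; rewrite /uniform_prob integral_uniform_pdf.
rewrite (eq_integral (fun=> 1%:E)); last first.
  by move=> x; rewrite inE/= in_itv/= /uniform_pdf => -[_ ->]; rewrite subr0 invr1.
by rewrite integral_cst ?mul1e//; exact: measurableI.
Qed.

Lemma circle_lebesgue_atomless (x : circle R) : circle_lebesgue R [set x] = 0%E.
Proof.
rewrite /circle_lebesgue /distribution /pushforward/=.
have mA : measurable (@circle_pi R @^-1` [set x] : set (measurableTypeR R)).
  rewrite -[X in measurable X]setTI; apply: circle_pi_measurable => //.
  exact: measurable_circle1.
have /null_content_dominatesP dom := dominates_uniform_prob (@ltr01 R).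
apply: dom => //; apply: countable_lebesgue_measure0.
rewrite (_ : _ @^-1` _ = (fun m : int => kappa x + m%:~R) @` setT); last first.
  apply/seteqP; split => [u /= <-|u [m _ <-]] /=; last by rewrite circle_piDz kappaK.
  by exists (Num.floor u) => //; rewrite kappa_pi subrK.
by apply: sub_countable (card_image_le _ _) _.
Qed.

Lemma lcdf_lebesgue : lcdf (circle_lebesgue R) id.
Proof.
apply: (@lcdf_shift _ _ _ _ 0 _ (atomless_lcdf circle_lebesgue_atomless)) => t.
rewrite addr0 (_ : mass_below _ _ = fracp t) ?subrK//.
have [t0 t1] := (fracp_ge0 t, fracp_lt1 t); move: (fracp t) t0 t1 => {}t t0 t1.
rewrite /mass_below /circle_lebesgue /distribution /pushforward/=.
rewrite uniform_prob01E; last first.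
  rewrite -[X in measurable X]setTI; apply: (@circle_pi_measurable R) => //.
  exact: measurable_kappa_le.
(* The endpoint 1 projects to the same point as 0, hence an extra null point. *)
have -> : [set s | kappa (circle_pi s) <= t] `&` `[0%R, 1%R] = `[0, t] `|` [set 1].
  apply/seteqP; split => s /=; rewrite !in_itv/= kappa_pi.
    move=> [st s01]; have [s1|s1] := ltP s 1; last by right; lra.
    by left; rewrite fracp_id in st; lra.
  case=> [s0|->]; first by rewrite fracp_id; [split; lra|lra].
  by rewrite /fracp (_ : Num.floor 1 = 1) ?subrr; [split; lra|apply: floor_def; rewrite intrD !mulr1z; lra].
rewrite measureU//; last first.
  by apply/seteqP; split => // s /=; rewrite in_itv/= => -[/andP[_ st] s1]; move: st; rewrite s1; lra.
transitivity (fine (t%:E + 0)%E); last by rewrite adde0.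
congr (fine (_ + _)%E); last exact: lebesgue_measure_set1.
apply: (etrans (lebesgue_measure_itv `[0, t])); rewrite /= lte_fin.
by case: ltP => t0'; rewrite ?sube0//; congr EFin; lra.
Qed.

End CircleLebesgue.

(** * The distance of the circle *)

Section CircleDist.
Variable R : realType.
Implicit Types (s t : R) (x y : circle R).

Lemma circle_dist_le s t : circle_dist (circle_pi s) (circle_pi t) <= `|s - t|.
Proof.
by apply: ge_inf; [exists 0 => _ [? _ [? _ <-]]|exists s => //; exists t].
Qed.

Lemma le_circle_dist (r : R) x y :
  (forall s t, circle_pi s = x -> circle_pi t = y -> r <= `|s - t|) ->
  r <= circle_dist x y.
Proof.
move=> h; apply: lb_le_inf; last by move=> _ [s /= sx [t /= ty <-]]; exact: h.
have [[s sx] [t ty]] := (circle_pi_surj x, circle_pi_surj y).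
by exists `|s - t|; exists s => //; exists t.
Qed.

Lemma circle_dist_ge0 x y : 0 <= circle_dist x y.
Proof. exact: le_circle_dist. Qed.

Lemma normz_ge1 (m : int) : m != 0 -> 1 <= `|m%:~R : R|.
Proof. by move=> m0; rewrite -intr_norm (_ : 1 = 1%:~R)// ler_int -gtz0_ge1 normr_gt0. Qed.

(** Translating s and t by distinct integers leaves them at distance at least 1 - |s - t|. Evaluated
    at [kappa], the formula makes the distance measurable. *)
Lemma circle_distE s t : `|s - t| <= 1 ->
  circle_dist (circle_pi s) (circle_pi t) = Num.min `|s - t| (1 - `|s - t|).
Proof.
move=> st1; apply/eqP; rewrite eq_le; apply/andP; split.
  rewrite le_min circle_dist_le/=.
  have [ts|ts] := leP t s.
    rewrite -(circle_piD1 t); apply: (le_trans (circle_dist_le _ _)).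
    by rewrite ler_norml; move: st1; rewrite ger0_norm; lra.
  rewrite -(circle_piD1 s); apply: (le_trans (circle_dist_le _ _)).
  by rewrite ler_norml; move: st1; rewrite ltr0_norm; lra.
apply: le_circle_dist => s' t' /circle_pi_eqz[m ->] /circle_pi_eqz[k ->].
have [->|mk] := eqVneq m k.
  by rewrite ge_min; apply/orP; left; rewrite opprD addrACA subrr addr0.
rewrite ge_min; apply/orP; right.
have := @normz_ge1 (m - k); rewrite subr_eq0 intrB => /(_ mk) h.
have := ler_normD (s + m%:~R - (t + k%:~R)) (t - s).
rewrite (_ : _ + (t - s) = m%:~R - k%:~R); last lra.
by rewrite (distrC t s); lra.
Qed.

Lemma circle_dist_lipschitz s t x :
  `|circle_dist (circle_pi s) x - circle_dist (circle_pi t) x| <= `|s - t|.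
Proof.
have half s' t' : circle_dist (circle_pi s') x - `|s' - t'| <= circle_dist (circle_pi t') x.
  apply: le_circle_dist => t'' u /circle_pi_eqz[m ->] ux; rewrite lerBlDr.
  rewrite -ux -(circle_piDz s' m); apply: (le_trans (circle_dist_le _ _)).
  rewrite (_ : s' + m%:~R - u = (t' + m%:~R - u) + (s' - t')); last lra.
  exact: ler_normD.
by rewrite ler_norml; have := half s t; have := half t s; rewrite (distrC t s); lra.
Qed.

Lemma measurable_circle_dist :
  measurable_fun setT (fun z : circle R * circle R => circle_dist z.1 z.2 : measurableTypeR R).
Proof.
have mk := @measurable_kappa R.
have h : measurable_fun setT (fun z : circle R * circle R => `|kappa z.1 - kappa z.2| : measurableTypeR R).
  apply: measurableT_comp => //; apply: measurable_funB.
    by apply: measurableT_comp => //; exact: measurable_fst.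
  by apply: measurableT_comp => //; exact: measurable_snd.
apply: (eq_measurable_fun (fun z : circle R * circle R =>
  Num.min `|kappa z.1 - kappa z.2| (1 - `|kappa z.1 - kappa z.2|) : measurableTypeR R)).
  move=> [x y] _ /=; rewrite -{3}(kappaK x) -{3}(kappaK y) circle_distE//.
  have [x1 x2] := (kappa_ge0 x, kappa_lt1 x); have [y1 y2] := (kappa_ge0 y, kappa_lt1 y).
  by rewrite ler_norml; lra.
by apply: measurable_minr => //; apply: measurable_funB.
Qed.

Lemma measurable_circle_dist2 :
  measurable_fun setT (fun z : circle R * circle R => ((circle_dist z.1 z.2) ^+ 2)%:E).
Proof.
by apply/measurable_EFinP; apply: (measurable_funX 2 measurable_circle_dist).
Qed.

End CircleDist.

(** * Quantile couplings and the metric W *)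

Section Coupling.
Variable R : realType.
Implicit Types (s t u e c : R) (nu mu : probability (circle R) R) (H g : R -> R).

Lemma measurable_quantile g : {mono g : s t / s <= t} ->
  measurable_fun setT (fun u : measurableTypeR R => circle_pi (g u)).
Proof.
move=> gm; apply: (measurableT_comp (@circle_pi_measurable R)).
by apply: nondecreasing_measurable => // s t; rewrite gm.
Qed.

Definition quantile_mfun g (gm : {mono g : s t / s <= t}) :
  {mfun measurableTypeR R >-> circle R} := mfun_of (measurable_quantile gm).

(** As [H] inverts [g], the preimage of the arc from s to t under u -> circle_pi (g u) is the
    preimage under [circle_pi] of the arc from H s to H t, whose Lebesgue mass is known. *)
Lemma lcdf_quantile H g (gm : {mono g : s t / s <= t}) :
  degmap H 1 -> cancel H g -> cancel g H ->
  lcdf (distribution (uniform_prob (@ltr01 R)) (quantile_mfun gm)) H.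
Proof.
move=> Hd Hg gH s t st; have [Hc Hm HD] := Hd.
have -> : (H t - H s)%:E = circle_lebesgue R (carc (H s) (H t)).
  rewrite lcdf_lebesgue// -[X in _ < _ + X](_ : 1%:R = 1)// -HD.
  by rewrite Hm (leW_mono Hm).
rewrite /circle_lebesgue /distribution /pushforward; congr (uniform_prob _ _).
apply/seteqP; split => u /carc_pi[m h]; apply/carc_pi; exists m.
  by rewrite -[u]gH -(mulr1 m%:~R) -(degmapDz _ _ Hd) !Hm.
by move: h; rewrite -{1 2}[u]gH -(mulr1 m%:~R) -(degmapDz _ _ Hd) !Hm mulr1.
Qed.

Lemma lcdf_exists H : degmap H 1 -> exists nu : probability (circle R) R, lcdf nu H.
Proof.
move=> Hd; have [g [Hg gH gm _ _]] := degmap_inv (ltn0Sn 0) Hd.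
by exists (distribution (uniform_prob (@ltr01 R)) (quantile_mfun gm)); exact: lcdf_quantile.
Qed.

Lemma lcdf_coupling nu mu H G e c : degmap H 1 -> degmap G 1 ->
  lcdf nu H -> lcdf mu G -> 0 < c ->
  (forall s t, s <= t -> c * (t - s) <= H t - H s) ->
  (forall t, `|H t - G t| <= e) ->
  exists2 Pi, coupling nu mu Pi &
    (\int[Pi]_z (circle_dist z.1 z.2 ^+ 2)%:E <= ((e / c) ^+ 2)%:E)%E.
Proof.
move=> Hd Gd nuH muG c0 slope HG.
have [h [Hh hH hm _ _]] := degmap_inv (ltn0Sn 0) Hd.
have [g [Gg gG gm _ _]] := degmap_inv (ltn0Sn 0) Gd.
have mhg : measurable_fun setT (fun u : measurableTypeR R => (quantile_mfun hm u, quantile_mfun gm u)).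
  by apply/measurable_fun_pairP; split; exact: measurable_funPT.
exists (distribution (uniform_prob (@ltr01 R)) (mfun_of mhg)).
  move=> A mA; rewrite -(lcdf_unique (lcdf_quantile hm Hd Hh hH) nuH mA).
  rewrite -(lcdf_unique (lcdf_quantile gm Gd Gg gG) muG mA).
  by split; congr (uniform_prob _ _); apply/seteqP; split => u //= [].
rewrite ge0_integral_distribution//; last 2 first.
- exact: measurable_circle_dist2.
- by move=> z; rewrite lee_fin sqr_ge0.
apply: (@le_trans _ _ (\int[uniform_prob (@ltr01 R)]_u (cst ((e / c) ^+ 2)%:E u))%E).
  apply: ge0_le_integral => //.
  - by move=> u _; rewrite lee_fin sqr_ge0.
  - by apply: measurableT_comp; [exact: measurable_circle_dist2|exact: measurable_funPT].
  move=> u _; rewrite lee_fin /=.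
  (* Since H (h u) = u = G (g u), the slope bound gives c |h u - g u| <= |H (g u) - G (g u)|. *)
  have hg : `|h u - g u| <= e / c.
    rewrite ler_pdivlMr// mulrC.
    have := HG (g u); rewrite gG ler_norml => Hgu; have Hhu := hH u.
    have [gh|hg] := leP (g u) (h u).
      by have := slope _ _ gh; rewrite ger0_norm; lra.
    by have := slope _ _ (ltW hg); rewrite ltr0_norm; lra.
  have d0 := circle_dist_ge0 (circle_pi (h u)) (circle_pi (g u)).
  have d1 := le_trans (circle_dist_le (h u) (g u)) hg.
  by rewrite lerXn2r ?nnegrE//; exact: le_trans d1.
rewrite integral_cst// [X in (_ * X)%E](_ : _ = 1%E) ?mule1//.
exact: (@probability_setT _ _ _ (uniform_prob (@ltr01 R))).
Qed.

Lemma W_le nu mu e : 0 <= e ->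
  (exists2 Pi, coupling nu mu Pi &
    (\int[Pi]_z (circle_dist z.1 z.2 ^+ 2)%:E <= (e ^+ 2)%:E)%E) ->
  W nu mu <= e.
Proof.
move=> e0 [Pi cPi le_e]; rewrite /W -[leRHS](ger0_norm e0) -sqrtr_sqr ler_wsqrtr//.
set I := ereal_inf _.
have Ie : (I <= (e ^+ 2)%:E)%E by apply: le_trans le_e; apply: ereal_inf_lbound; exists Pi.
have I0 : (0 <= I)%E.
  apply: le_ereal_inf_tmp => _ [Pi' _ <-].
  by apply: integral_ge0 => z _; rewrite lee_fin sqr_ge0.
by move: Ie I0; case: I => [r| |]; rewrite ?lee_fin//= ?leey// => + _.
Qed.

(** A coupling and finite costs are required because [fine] sends an infinite infimum to 0, which
    would ruin a lower bound. *)
Lemma W_ge nu mu e : 0 <= e -> coupling nu mu !=set0 ->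
  (forall Pi, coupling nu mu Pi ->
    ((e ^+ 2)%:E <= \int[Pi]_z (circle_dist z.1 z.2 ^+ 2)%:E < +oo)%E) ->
  e <= W nu mu.
Proof.
move=> e0 [Pi cPi] ge_e; rewrite /W -[leLHS](ger0_norm e0) -sqrtr_sqr ler_wsqrtr//.
set I := ereal_inf _.
have Ie : ((e ^+ 2)%:E <= I)%E.
  by apply: le_ereal_inf_tmp => _ [Pi' /ge_e/andP[? _] <-].
have : (I < +oo)%E.
  have /andP[_] := ge_e _ cPi; apply: le_lt_trans; apply: ereal_inf_lbound; exists Pi => //.
by move: Ie; case: I => [r| |]; rewrite ?lee_fin//.
Qed.

End Coupling.

(** * Push-forward as a transfer operator *)

Section Transfer.
Variable R : realType.
Implicit Types (s t u sg : R) (nu : probability (circle R) R) (p g H K : R -> R) (d : nat).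

Lemma sum_shift1 K d x :
  \sum_(j < d) K (x + 1 + j%:R) = \sum_(j < d) K (x + j%:R) + (K (x + d%:R) - K x).
Proof.
elim: d => [|d IH]; first by rewrite !big_ord0 addr0 subrr addr0.
rewrite !big_ord_recr/= IH (_ : x + 1 + d%:R = x + d.+1%:R); first lra.
by rewrite -natr1; lra.
Qed.

(* [g] inverts the increasing lift [sg * f], so [g (sg * t + j)], [j < d], lift the d
   preimages of [t]. *)
Definition transfer sg g d H t := sg * \sum_(j < d) H (g (sg * t + j%:R)).

(** The preimage of an arc splits into d disjoint arcs, one for each inverse branch. It enters only
    through its lift by the increasing [p], which leaves the orientation to the caller. *)
Lemma branch_mass p d g nu H s t (A : set (circle R)) :
  (0 < d)%N -> degmap p d -> cancel p g -> cancel g p ->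
  {mono g : s t / s <= t} -> (forall t (m : int), g (t + m%:~R * d%:R) = g t + m%:~R) ->
  lcdf nu H -> s <= t < s + 1 ->
  (forall u, A (circle_pi u) <-> carc s t (circle_pi (p u))) ->
  nu A = (\sum_(j < d) (H (g (t + j%:R)) - H (g (s + j%:R))))%:E.
Proof.
move=> d0 pd pg gp gm gD nuH st AE; have [pc pm pD] := pd.
have d1 : 1 <= d%:R :> R by rewrite ler1n.
pose F j := carc (g (s + j%:R)) (g (t + j%:R)).
have width j : g (s + j%:R) <= g (t + j%:R) < g (s + j%:R) + 1.
  rewrite gm -[X in _ < _ + X]/(1%:~R) -gD (leW_mono gm) mul1r.
  by apply/andP; split; lra.
have FE j u : F j (circle_pi u) <-> exists m : int, s + j%:R <= p u + m%:~R * d%:R <= t + j%:R.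
  split => [/carc_pi[m h]|[m h]]; [|apply/carc_pi]; exists m.
    by rewrite -(degmapDz _ _ pd) -[s + _]gp -[t + _]gp !pm.
  by rewrite -[_ + m%:~R]pg !gm (degmapDz _ _ pd).
have -> : A = \big[setU/set0]_(j < d) F j.
  rewrite -bigcup_mkord; apply/seteqP; split => x; have [u <-] := circle_pi_surj x.
    (* If p u + m lies in [s, t], the branch index is j = -m mod d, and the quotient becomes the
       integer translation of u. *)
    move=> /AE/carc_pi[m h]; exists (`|(- m %% d)%Z|)%N.
      by rewrite /= -ltz_nat gez0_abs ?modz_ge0 ?ltz_pmod -?lt0n//; case: (d) d0.
    apply/FE; exists (- (- m %/ d)%Z).
    have : (- m)%:~R = ((- m %/ d)%Z)%:~R * d%:R + (`|(- m %% d)%Z|)%:R :> R.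
      rewrite {1}(divz_eq (- m) d) intrD intrM; congr (_ + _).
      rewrite -[RHS]/((`|(- m %% d)%Z|%:Z)%:~R) gez0_abs// modz_ge0//.
      by case: (d) d0.
    by rewrite !intrN; lra.
  case=> j /= jd /FE[m h]; apply/AE/carc_pi.
  exists (m * d%:Z - j%:Z); rewrite intrB intrM; move: h.
  by rewrite -[j%:~R]/(j%:R) -[d%:~R]/(d%:R); lra.
rewrite measure_bigsetU_ord//; last 2 first.
- by move=> j; apply: measurable_carc.
- move=> i j _ _ [x []]; have [u <-] := circle_pi_surj x.
  move=> /FE[m hi] /FE[k hj]; apply/val_inj => /=.
  have := ltn_ord i; have := ltn_ord j.
  move: (nat_of_ord i) (nat_of_ord j) hi hj => {}i {}j hi hj jd id.
  (* As t - s < 1, a point common to two branches forces (m - k) d = i - j, and |i - j| < d then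
     leaves only i = j. *)
  have : -1 < (((m - k) * d%:Z - (i%:Z - j%:Z))%:~R : R) < 1.
    rewrite intrB intrM !intrB -[i%:~R]/(i%:R) -[j%:~R]/(j%:R) -[d%:~R]/(d%:R); lra.
  rewrite -[X in _ < _ < X]/((1%:Z)%:~R) -[X in X < _ < _]/((-1%:Z)%:~R) !ltr_int.
  have [|mk] := eqVneq m k; first by move=> ->; lia.
  have [mk0|mk0] := ltP 0 (m - k); first by nia.
  nia.
by rewrite -sumEFin; apply: eq_bigr => j _; exact: nuH.
Qed.

Lemma circle_piN_carc s t u : carc s t (circle_pi (- u)) <-> carc (- t) (- s) (circle_pi u).
Proof.
by split => /carc_pi[m h]; apply/carc_pi; exists (- m); rewrite intrN; lra.
Qed.

(** For sg = -1 the preimage of [s, t] under f = - p is the p-preimage of [-t, -s]; the exchange of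
    endpoints accounts for the factor [sg] in front of the sum. *)
Lemma lcdf_transfer p d g sg f (Q : circle R -> circle R) nu H s t :
  (0 < d)%N -> degmap p d -> cancel p g -> cancel g p ->
  {mono g : s t / s <= t} -> (forall t (m : int), g (t + m%:~R * d%:R) = g t + m%:~R) ->
  sg = 1 \/ sg = -1 -> (forall u, f u = sg * p u) -> is_lift f Q ->
  lcdf nu H -> s <= t < s + 1 ->
  nu (Q @^-1` (carc s t)) = (transfer sg g d H t - transfer sg g d H s)%:E.
Proof.
move=> d0 pd pg gp gm gD sgE fE fQ nuH st; rewrite /transfer.
case: sgE fE => -> fE.
  rewrite (branch_mass d0 pd pg gp gm gD nuH st); last first.
    by move=> u; rewrite /= -fQ fE mul1r.
  by rewrite !mul1r sumrB.
have Nst : - t <= - s < - t + 1 by lra.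
rewrite (branch_mass d0 pd pg gp gm gD nuH Nst); last first.
  by move=> u; rewrite /= -fQ fE mulN1r; exact: circle_piN_carc.
by rewrite !mulN1r sumrB; congr EFin; lra.
Qed.

End Transfer.

(** * Lifts of expanding maps *)

Section ExpandingLift.
Variable R : realType.
Implicit Types (s t u sg : R) (f p g : R -> R) (d : nat).

Lemma periodic_fracp g s : (forall t, g (t + 1) = g t) -> g (fracp s) = g s.
Proof.
move=> gD; have gDn n t : g (t + n%:R) = g t.
  by elim: n t => [|n IH] t; rewrite ?addr0// -natr1 addrA gD.
have gDz (m : int) t : g (t + m%:~R) = g t.
  case: m => n; first exact: gDn.
  by rewrite -[LHS](gDn n.+1) NegzE intrN subrK.
by rewrite /fracp -intrN gDz.
Qed.

Lemma derivable_is_derive f s : derivable f s 1 -> is_derive s 1 f (derive1 f s).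
Proof. by move=> /derivableP; rewrite derive1E. Qed.

Lemma derivable_continuous f : (forall s, derivable f s 1) -> continuous f.
Proof.
by move=> df s; apply: differentiable_continuous; apply/derivable1_diffP.
Qed.

Lemma derive1_shift f (c : R) : (forall s, derivable f s 1) ->
  (forall s, f (s + 1) = f s + c) -> forall s, derive1 f (s + 1) = derive1 f s.
Proof.
move=> df fD s.
have h1 : is_derive s 1 (f \o shift 1) (derive1 f (s + 1)).
  have hs : is_derive s 1 (shift (1 : R)) 1 by apply: is_derive_eq; rewrite ?addr0.
  have hf : is_derive (shift 1 s) 1 f (derive1 f (s + 1)) by exact: derivable_is_derive.
  by have := is_derive1_comp; move=> /(_ _ f (shift 1) s _ _ hf hs); rewrite mulr1.
have h2 : is_derive s 1 (f \o shift 1) (derive1 f s).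
  rewrite (_ : f \o shift 1 = f + cst c); last by apply/funext => u; rewrite /= fD.
  have hf := derivable_is_derive (df s).
  by apply: is_derive_eq; rewrite addr0.
by rewrite -(@derive_val _ _ _ _ _ _ _ h1) -(@derive_val _ _ _ _ _ _ _ h2).
Qed.

(** The difference f (s + 1) - f s is continuous with integer values. If it were not constant, it
    would take a value half-way past an integer. *)
Lemma lift_period f (Phi : circle R -> circle R) : continuous f -> is_lift f Phi ->
  exists c : int, forall s, f (s + 1) = f s + c%:~R.
Proof.
move=> fc fPhi; pose h s := f (s + 1) - f s.
have hZ s : exists m : int, h s = m%:~R.
  have [m hm] : exists m : int, f (s + 1) = f s + m%:~R.
    by apply/circle_pi_eqz; rewrite !fPhi circle_piD1.
  by exists m; rewrite /h hm addrAC subrr add0r.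
have hc : continuous h.
  move=> s; apply: continuousB; last exact: fc.
  apply: (@continuous_comp R R R (fun u => u + 1) f); last exact: fc.
  by apply: cvgD; [exact: cvg_id|exact: cvg_cst].
have key a b : a <= b -> h a = h b.
  move=> ab; have [[m ha] [k hb]] := (hZ a, hZ b).
  apply/eqP/negPn/negP => hab.
  have mk : m <> k by move=> mk; move/eqP: hab; apply; rewrite ha hb mk.
  have : exists2 c, c \in `[a, b] & h c = Num.min (h a) (h b) + 2^-1.
    apply: (IVT ab (continuous_subspaceT hc)).
    rewrite lerDl invr_ge0 ler0n/= ha hb.
    have : (m + 1 <= k) || (k + 1 <= m) by lia.
    case/orP; rewrite -(ler_int R) intrD => mk1.
      by rewrite minEle maxEle !ifT; lra.
    by rewrite minC maxC minEle maxEle !ifT; lra.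
  case=> c _; have [j ->] := hZ c; rewrite ha hb => /eqP.
  have [l ->] : exists l : int, Num.min (m%:~R : R) k%:~R = l%:~R.
    by case: (leP (m%:~R : R)) => _; eexists.
  move=> /eqP jE; have : l%:~R < (j%:~R : R) < (l + 1)%:~R by rewrite intrD jE; lra.
  by rewrite !ltr_int; lia.
have [c hc0] := hZ 0; exists c => s.
suff <- : h s = c%:~R by rewrite /h addrCA subrr addr0.
by rewrite -hc0; have [s0|s0] := leP s 0; [|symmetry]; apply: key => //; exact: ltW.
Qed.

Lemma derivable_const_sign f : (forall s, derivable f s 1) -> continuous (derive1 f) ->
  (forall s, 1 < `|derive1 f s|) ->
  exists sg, (sg = 1 \/ sg = -1) /\ forall s, 1 < sg * derive1 f s.
Proof.
move=> df cf' f'1.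
have key s : 0 < derive1 f 0 * derive1 f s.
  rewrite ltNge; apply/negP => neg.
  have [||c _ c0] := @IVT R (derive1 f) (Num.min 0 s) (Num.max 0 s) 0 _ (continuous_subspaceT cf').
  - by rewrite le_max !ge_min lexx.
  - case: (leP 0 s) => _; rewrite ge_min le_max; have := f'1 0; have := f'1 s;
    rewrite !real_ltr_normr ?num_real//; nra.
  by have := f'1 c; rewrite c0 normr0 ltr10.
have := f'1 0; rewrite ltr_normr => /orP[h0|h0].
  exists 1; split; [by left|] => s; rewrite mul1r; have := key s; have := f'1 s.
  by rewrite ltr_normr => /orP[] //; nra.
exists (-1); split; [by right|] => s; rewrite mulN1r; have := key s; have := f'1 s.
by rewrite ltr_normr => /orP[] //; nra.
Qed.

(** All that is kept of the C^2 hypothesis: bounds on slopes, and the comparison of average slopes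
    on two subintervals of [a, b] up to a factor 1 + B (b - a). The products avoid dividing by the
    length of degenerate intervals. *)
Definition expanding_lift p d (La D B : R) :=
  [/\ degmap p d, 1 < La,
   (forall s t, s <= t -> La * (t - s) <= p t - p s <= D * (t - s)),
   0 <= B &
   forall a b x y x' y', a <= x <= y -> y <= b -> a <= x' <= y' -> y' <= b ->
     (p y - p x) * (y' - x') <= (1 + B * (b - a)) * ((p y' - p x') * (y - x))].

Lemma periodic_bounds g : continuous g -> (forall s, g (s + 1) = g s) ->
  exists a b, forall s, g a <= g s <= g b.
Proof.
move=> gc gD; have cw := continuous_subspaceT gc.
have [a _ ha] := EVT_min (@ler01 R) (cw _); have [b _ hb] := EVT_max (@ler01 R) (cw _).
exists a, b => s; rewrite -(periodic_fracp s gD).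
have fs : fracp s \in `[0, 1] by rewrite in_itv/= fracp_ge0 ltW// fracp_lt1.
by rewrite ha// hb.
Qed.

Lemma expanding_liftP (Phi : circle R -> circle R) : C2_expanding Phi ->
  exists f p sg, exists d : nat, exists La D B,
    [/\ is_lift f Phi, sg = 1 \/ sg = -1, forall u, f u = sg * p u, (1 < d)%N
      & expanding_lift p d La D B].
Proof.
move=> [f [fPhi [df ddf cf''] f'1]].
have cf := derivable_continuous df; have cf' := derivable_continuous ddf.
have [sg [sgE sgf']] := derivable_const_sign df cf' f'1.
have sg2 : sg * sg = 1 by case: sgE => ->; lra.
have [c fD] := lift_period cf fPhi.
have f'D := derive1_shift df fD.
have f'D0 s : derive1 f (s + 1) = derive1 f s + 0 by rewrite f'D addr0.
have f''D := derive1_shift ddf f'D0.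
have mvt (h : R -> R) : (forall s, derivable h s 1) -> forall s t, s <= t ->
    exists2 xi, s <= xi <= t & h t - h s = derive1 h xi * (t - s).
  move=> dh s t st; have [||xi] := @MVT_segment R h (derive1 h) s t st.
  - by move=> x _; exact: derivable_is_derive.
  - by apply: continuous_subspaceT; exact: derivable_continuous.
  by rewrite in_itv/= => sxit; exists xi.
pose p s := sg * f s.
have pmvt s t : s <= t -> exists2 xi, s <= xi <= t & p t - p s = sg * derive1 f xi * (t - s).
  by move=> /(mvt _ df)[xi ? h]; exists xi => //; rewrite /p -mulrBr h mulrA.
have cp' : continuous (fun s => sg * derive1 f s).
  by move=> s; apply: continuousM; [exact: cst_continuous|exact: cf'].
(* By periodicity the slope attains its bounds over the whole line; these are the constants La and D
   of the conclusion. *)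
have [||a [b ab]] := @periodic_bounds (fun s => sg * derive1 f s) => //.
  by move=> s; rewrite f'D.
have [||a' [b' ab']] := @periodic_bounds (derive1 (derive1 f)) => //.
pose B := Num.max `|derive1 (derive1 f) a'| `|derive1 (derive1 f) b'|.
have f''B s : `|derive1 (derive1 f) s| <= B.
  have /andP[h1 h2] := ab' s; rewrite /B le_max.
  have := ler_norm (derive1 (derive1 f) b'); have := ler_norm (- derive1 (derive1 f) a').
  rewrite normrN; move: (derive1 _ a') (derive1 _ b') (derive1 _ s) h1 h2 => x y z xz zy hx hy.
  have [z0|z0] := leP 0 z; apply/orP; [right|left]; first by rewrite ger0_norm//; lra.
  by rewrite ltr0_norm//; lra.
have B0 : 0 <= B by apply: le_trans (f''B 0).
have pD s : p (s + 1) = p s + sg * c%:~R by rewrite /p fD mulrDr.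
have sgc1 : 1 < sg * c%:~R.
  have [xi _] := pmvt 0 1 ler01; have := pD 0; rewrite add0r => ->.
  by have := sgf' xi; lra.
have [d dE] : exists d : nat, sg * c%:~R = d%:R.
  case: sgE sgc1 => ->; rewrite ?mul1r ?mulN1r -?intrN -[X in X < _]/(1%:~R) ltr_int => h.
    by exists `|c|%N; rewrite -[RHS]/(`|c|%:Z%:~R) gez0_abs//; lia.
  by exists `|- c|%N; rewrite -[RHS]/(`|- c|%:Z%:~R) gez0_abs//; lia.
exists f, p, sg, d, (sg * derive1 f a), (sg * derive1 f b), B; split => //.
- by move=> u; rewrite /p mulrA sg2 mul1r.
- by rewrite -(ltr_nat R) -dE.
split => //.
- split.
  + by move=> s; apply: continuousM; [exact: cst_continuous|exact: cf].
  + apply: homo_lt_mono_le => s t st; have [xi _ h] := pmvt _ _ (ltW st).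
    by rewrite -subr_gt0 h mulr_gt0 ?subr_gt0//; have := sgf' xi; lra.
  + by move=> s; rewrite pD dE.
- move=> s t st; have [xi _ ->] := pmvt _ _ st; have /andP[h1 h2] := ab xi.
  by rewrite !ler_wpM2r ?subr_ge0.
- move=> a0 b0 x y x' y' ax yb ax' yb'.
  have [|xi xiP ->] := pmvt x y; first by case/andP: ax.
  have [|xi' xiP' ->] := pmvt x' y'; first by case/andP: ax'.
  have f'L u v : a0 <= u <= b0 -> a0 <= v <= b0 -> `|derive1 f u - derive1 f v| <= B * (b0 - a0).
    wlog uv : u v / u <= v.
      move=> hw hu hv; have [uv|/ltW vu] := leP u v; first exact: hw.
      by rewrite distrC; exact: hw.
    move=> hu hv; have [zeta _ h] := mvt _ ddf _ _ uv.
    rewrite distrC h normrM (ger0_norm (_ : 0 <= v - u)) ?subr_ge0//.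
    by apply: ler_pM => //; lra.
  have L : sg * derive1 f xi <= sg * derive1 f xi' + B * (b0 - a0).
    rewrite addrC -lerBlDr -mulrBr; apply: (le_trans (ler_norm _)); rewrite normrM.
    rewrite (_ : `|sg| = 1); last by case: sgE => ->; rewrite ?normrN normr1.
    by rewrite mul1r; apply: f'L; lra.
  have S : 1 <= sg * derive1 f xi' by exact: ltW.
  have Q : 0 <= (y - x) * (y' - x') by apply: mulr_ge0; lra.
  have BB : 0 <= B * (b0 - a0) by apply: mulr_ge0 => //; lra.
  move: (sg * derive1 f xi) (sg * derive1 f xi') L S => w w' L S.
  have -> : w * (y - x) * (y' - x') = w * ((y - x) * (y' - x')) by lra.
  have -> : (1 + B * (b0 - a0)) * (w' * (y' - x') * (y - x)) =
     (1 + B * (b0 - a0)) * w' * ((y - x) * (y' - x')) by lra.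
  (* The additive error B (b0 - a0) on the slope is also a relative one, because slopes are at least
     1. *)
  apply: ler_wpM2r => //; apply: (le_trans L); rewrite mulrDl mul1r lerD2l.
  by rewrite ler_peMr.
Qed.

End ExpandingLift.

(** * Bounded distortion of iterates *)

Section IteratedDistortion.
Variable R : realType.
Implicit Types (s t u sg La D B E : R) (f p q : R -> R) (d : nat).

(** The comparison is restricted to intervals that [q] maps to length at most 1, because only there
    is the distortion of the iterates bounded uniformly. *)
Definition bounded_distortion q d La E :=
  [/\ degmap q d, forall s t, s <= t -> La * (t - s) <= q t - q s &
   forall a b x y x' y', a <= x <= y -> y <= b -> a <= x' <= y' -> y' <= b ->
     q b - q a <= 1 -> (q y - q x) * (y' - x') <= E * ((q y' - q x') * (y - x))].

Lemma bounded_distortionN q d La E :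
  bounded_distortion q d La E -> bounded_distortion (fun u => - q (- u)) d La E.
Proof.
move=> [[qc qm qD] qL qE]; split.
- split.
  + move=> s; apply: continuousN; apply: (@continuous_comp R R R -%R q); last exact: qc.
    exact: oppr_continuous.
  + by move=> s t; rewrite lerN2 qm lerN2.
  + by move=> s; rewrite (_ : - s = - (s + 1) + 1) ?qD; lra.
- by move=> s t st; have := qL (- t) (- s); rewrite lerN2 => /(_ st); lra.
move=> a b x y x' y' axy yb axy' yb' h.
have := qE (- b) (- a) (- y) (- x) (- y') (- x'); rewrite !lerN2 => h'.
by have := h' _ _ _ _ _; lra.
Qed.

Lemma bounded_distortion_comp p q d d' La La' D B E : (0 < d)%N ->
  0 < La' -> 0 <= E ->
  expanding_lift p d La D B -> bounded_distortion q d' La' E ->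
  bounded_distortion (q \o p) (d' * d) (La' * La) (E * (1 + B / (La' * La))).
Proof.
move=> d0 La'0 E0 [pd La1 pL B0 pdist] [qd qL qE].
have [pc pm pD] := pd; have [qc qm qD] := qd.
have qpL s t : s <= t -> La' * La * (t - s) <= q (p t) - q (p s).
  move=> st; have /andP[h _] := pL _ _ st.
  have := qL (p s) (p t); rewrite pm => /(_ st); apply: le_trans.
  by rewrite -mulrA ler_pM2l.
split => //.
- split.
  + by move=> s; apply: continuous_comp; [exact: pc|exact: qc].
  + by move=> s t; rewrite /= qm pm.
  + by move=> s; rewrite /= pD (degmapDn _ _ qd) mulnC.
move=> a b x y x' y' axy yb axy' yb' /= qab.
have LL : 0 < La' * La by rewrite mulr_gt0//; lra.
have ab : a <= b by lra.
(* An interval with image of length at most 1 is this short, which bounds the distortion contributed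
   by [p]. *)
have bal : b - a <= (La' * La)^-1.
  by rewrite -[leRHS]mul1r ler_pdivlMr// mulrC; exact: le_trans (qpL _ _ ab) qab.
have [/andP[ax xy] /andP[ax' xy']] := (axy, axy').
have [->|xyn] := eqVneq x y; first by rewrite !subrr !mul0r !mulr0.
have [->|xyn'] := eqVneq x' y'; first by rewrite !subrr !(mulr0, mul0r).
have pxy : 0 < p y - p x by rewrite subr_gt0 (leW_mono pm) lt_neqAle xyn.
have pxy' : 0 < p y' - p x' by rewrite subr_gt0 (leW_mono pm) lt_neqAle xyn'.
have h1 : (q (p y) - q (p x)) * (p y' - p x') <= E * ((q (p y') - q (p x')) * (p y - p x)).
  by apply: (qE (p a) (p b)) => //; rewrite ?pm//; apply/andP; rewrite !pm.
have h2 : (p y - p x) * (y' - x') <= (1 + B / (La' * La)) * ((p y' - p x') * (y - x)).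
  apply: (le_trans (pdist a b x y x' y' axy yb axy' yb')).
  apply: ler_wpM2r; last by rewrite lerD2l ler_wpM2l.
  by apply: mulr_ge0; lra.
have Q : 0 <= q (p y) - q (p x) by rewrite subr_ge0 qm pm.
have Q' : 0 <= q (p y') - q (p x') by rewrite subr_ge0 qm pm.
(* Chain rule for average slopes: [h1] and [h2] are multiplied, and this common factor is
   cancelled. *)
have K : 0 < (p y - p x) * (p y' - p x') by rewrite mulr_gt0.
rewrite -(ler_pM2r K).
have C0 : 0 <= B / (La' * La) by rewrite divr_ge0// ltW.
move: (q (p y) - _) (q (p y') - _) (p y - _) (p y' - _) (1 + _) h1 h2 Q Q' pxy pxy' {K}.
move=> A A' P P' C h1 h2 A0 A'0 P0 P'0.
have := ler_pM (mulr_ge0 A0 (ltW P'0)) (mulr_ge0 (ltW P0) (_ : 0 <= y' - x')) h1 h2.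
rewrite subr_ge0 => /(_ xy'); rewrite !mulrA => h.
by apply: le_trans (le_trans _ h) _; rewrite le_eqVlt; apply/orP; left; apply/eqP; ring.
Qed.

(** The exponent is the sum of B La^-j for 1 <= j <= k: the step to k + 1 contributes a factor 1 + B
    La^-(k+1), at most the exponential of the new summand. It stays below B / (La - 1) for all k.
    For sg = -1, the inner map [q] is conjugated by u -> -u to remain increasing. *)
Lemma iter_bounded_distortion f p sg d La D B k : (0 < d)%N ->
  sg = 1 \/ sg = -1 -> (forall u, f u = sg * p u) -> expanding_lift p d La D B ->
  exists q sgk, [/\ sgk = 1 \/ sgk = -1, forall u, iter k f u = sgk * q u
    & bounded_distortion q (d ^ k) (La ^+ k) (expR (B / (La - 1) * (1 - La ^- k)))].
Proof.
move=> d0 sgE fE pL; have [pd La1 pbd B0 _] := pL.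
elim: k => [|k [q [sgk [sgkE qE qd]]]].
  exists id, 1; split; [by left|by move=> u; rewrite mul1r|].
  rewrite expr0 invr1 subrr mulr0 expR0; split.
  - by split => // s; exact: cvg_id.
  - by move=> s t _; rewrite mul1r.
  - by move=> *; rewrite mul1r mulrC.
have Lk0 : 0 < La ^+ k by rewrite exprn_gt0//; lra.
have Lk1 : 0 < La ^+ k.+1 by rewrite exprn_gt0//; lra.
have weaken q' : bounded_distortion q' (d ^ k) (La ^+ k) (expR (B / (La - 1) * (1 - La ^- k))) ->
    bounded_distortion (q' \o p) (d ^ k.+1) (La ^+ k.+1) (expR (B / (La - 1) * (1 - La ^- k.+1))).
  move=> q'd; have := @bounded_distortion_comp p q' d (d ^ k) La (La ^+ k) D B _ d0 Lk0 (expR_ge0 _) pL q'd.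
  rewrite -expnSr -exprSr => -[h1 h2 h3]; split => //.
  move=> a b x y x' y' axy yb axy' yb' ab.
  apply: (le_trans (h3 _ _ _ _ _ _ axy yb axy' yb' ab)).
  have [_ qm _] := h1.
  apply: ler_wpM2r.
    by apply: mulr_ge0; rewrite ?subr_ge0 ?qm; lra.
  rewrite /=; apply: (@le_trans _ _ (expR (B / (La - 1) * (1 - La ^- k)) * expR (B / La ^+ k.+1))).
    by rewrite ler_pM2l ?expR_gt0// expR_ge1Dx.
  rewrite -expRD ler_expR le_eqVlt; apply/orP; left; apply/eqP.
  have L1 : La - 1 != 0 by rewrite gt_eqF//; lra.
  have L0 : La != 0 by rewrite gt_eqF//; lra.
  have Lk : La ^+ k != 0 by rewrite gt_eqF.
  by rewrite exprSr; field; rewrite L0 L1 Lk.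
case: sgE fE => -> fE.
  exists (q \o p), sgk; split => //; last exact: weaken.
  by move=> u; rewrite iterSr qE fE mul1r.
exists ((fun u => - q (- u)) \o p), (- sgk); split.
- by case: sgkE => ->; [right|left]; lra.
- by move=> u; rewrite iterSr qE fE mulN1r /=; lra.
by apply: weaken; exact: bounded_distortionN.
Qed.

End IteratedDistortion.

(** * Absolutely continuous measures at small scales *)

Section AbsolutelyContinuous.
Variable R : realType.
Implicit Types (x y e del : R) (mu : probability (circle R) R) (G g : R -> R).

Lemma segment_unif_continuous g e : continuous g -> 0 < e ->
  exists2 del : R, 0 < del & forall x y, 0 <= x <= 1 -> `|x - y| <= del -> `|g x - g y| <= e.
Proof.
move=> gc e0.
have nc0 x : \forall x' \near x & del \near 0^'+,
    forall y, `|x' - y| <= del -> `|g x' - g y| <= e.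
  have e2 : 0 < e / 2 by lra.
  have /cvgrPdist_lt/(_ _ e2) := gc x.
  move=> /nbhs_ballP[r /= r0 hr]; have r2 : 0 < r / 2 by lra.
  near=> x' del => y /= x'y.
  have x'x : `|x - x'| < r / 2 by near: x'; exact: (@nbhsx_ballx R R x (r / 2)).
  have dr : del < r / 2 by near: del; exact: nbhs_right_lt.
  have h1 : `|g x - g x'| < e / 2 by apply: hr; apply: (lt_trans x'x); lra.
  have h2 : `|g x - g y| < e / 2.
    apply: hr; have := ler_normD (x - x') (x' - y).
    by rewrite subrKA => h; apply: (le_lt_trans h); lra.
  rewrite (_ : g x' - g y = (g x - g y) - (g x - g x')); last lra.
  by apply: (le_trans (ler_normB _ _)); lra.
have /compact_near_coveringP nc := @segment_compact R 0 1.
have := nc _ (0^'+) (fun (del : R) x => forall y, `|x - y| <= del -> `|g x - g y| <= e) _ (fun x _ => nc0 x).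
move=> /(_ _); rewrite near_withinE => /nbhs_ballP[r /= r0 hr].
exists (r / 2); first lra.
move=> x y x01 xy; apply: (hr (r / 2)) => //=; [|lra].
by rewrite /ball/= sub0r normrN ger0_norm; lra.
Unshelve. all: by end_near. Qed.

(** [kappa] moves [mu] to the line, where the Radon-Nikodym theorem is applied; the endpoint 1 of
    the uniform law only contributes a null point. *)
Lemma kappa_density mu : mu `<< circle_lebesgue R ->
  exists r : R -> R, [/\ forall x, 0 <= r x, lebesgue_measure.-integrable setT (EFin \o r) &
    forall A : set (measurableTypeR R), measurable A ->
     mu (@kappa R @^-1` A) = (\int[lebesgue_measure]_(x in A) (r x)%:E)%E].
Proof.
move=> /null_content_dominatesP mul; have mk := @measurable_kappa R.
have : distribution mu (mfun_of mk) `<< @lebesgue_measure R.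
  apply/null_content_dominatesP => A mA A0; apply: mul.
    by rewrite -[X in measurable X]setTI; exact: mk.
  rewrite /circle_lebesgue /distribution /pushforward /=.
  rewrite uniform_prob01E; last first.
    rewrite -[X in measurable X]setTI; apply: (@circle_pi_measurable R) => //.
    by rewrite -[X in measurable X]setTI; exact: mk.
  apply/eqP; rewrite -measure_le0.
  apply: (@le_trans _ _ (lebesgue_measure (A `|` [set 1]))).
    apply: le_measure; rewrite ?inE.
    - apply: measurableI => //.
      rewrite -[X in measurable X]setTI; apply: (@circle_pi_measurable R) => //.
      by rewrite -[X in measurable X]setTI; exact: mk.
    - exact: measurableU.
    move=> u [/=]; rewrite kappa_pi in_itv/= => Au u01.
    have [u1|u1] := ltP u 1; last by right; rewrite /=; lra.
    by left; rewrite fracp_id in Au => //; lra.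
  by rewrite -[leRHS](adde0 0%E) -{1}A0 -(lebesgue_measure_set1 1); exact: measureU2.
move=> /radon_nikodym_sigma_finite[rho [rho0 rhofin irho rhoE]].
exists (fine \o rho); split.
- by move=> x; rewrite fine_ge0.
- by rewrite (_ : _ \o _ = rho)//; apply/funext => x /=; rewrite fineK.
- move=> A mA; rewrite -[LHS]/(distribution mu (mfun_of mk) A) rhoE//.
  by apply: eq_integral => x _; rewrite /= fineK.
Qed.

Lemma lcdf_kappa_oc mu G x y : lcdf mu G -> 0 <= x <= y -> y < 1 ->
  mu (@kappa R @^-1` `]x, y]) = (G y - G x)%:E.
Proof.
move=> muG xy y1; have mk := @measurable_kappa R.
have mB : measurable (@kappa R @^-1` `]x, y]).
  by rewrite -[X in measurable X]setTI; exact: mk.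
rewrite -muG; last lra.
have -> : carc x y = @kappa R @^-1` `]x, y] `|` [set circle_pi x].
  apply/seteqP; split => [z [u /= uxy <-]|z [/=|->]].
  - have [xu|ux] := ltP x u; [left|right; congr circle_pi; lra].
    by rewrite /= in_itv/= kappa_pi fracp_id; lra.
  - by rewrite /= in_itv/= => h; exists (kappa z); rewrite ?kappaK//=; lra.
  - by exists x => //=; lra.
rewrite measure_setU_null//; last 2 first.
- exact: measurable_circle1.
- rewrite (_ : _ `&` _ = set0) ?measure0//; apply/seteqP; split => // z [/=].
  by rewrite /= in_itv/= => h zx; move: h; rewrite zx kappa_pi fracp_id; lra.
by rewrite [X in (_ + X)%E](lcdf_atomless _ muG) adde0.
Qed.

(** I is an interval and J a subinterval with at least the fraction b of its length; l is length, G
    mass, and N the L^1 distance from the density to a function within e / 4 of the constant c. Then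
    J has at least the fraction b of the mass of I, up to the errors. *)
Lemma almost_uniform_arith (e c b lI lJ GI GJ NI NJ : R) :
  0 <= e -> 0 <= c -> 0 <= b <= 1 -> b * lI <= lJ -> lJ <= lI ->
  c * lJ <= GJ + NJ + e / 4 * lJ -> GI <= c * lI + e / 4 * lI + NI ->
  0 <= NJ <= NI -> b * GI - (2 * NI + e / 2 * lI) <= GJ.
Proof.
move=> e0 c0 /andP[b0 b1] blI lJI hJ hI /andP[NJ0 NJI].
have bI : b * GI <= b * (c * lI + e / 4 * lI + NI) by rewrite ler_wpM2l.
have ce : (c + e / 4) * (b * lI) <= (c + e / 4) * lJ by rewrite ler_wpM2l//; lra.
have bN : b * NI <= 1 * NI by rewrite ler_wpM2r//; lra.
have eJI : e / 4 * lJ <= e / 4 * lI by rewrite ler_wpM2l//; lra.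
lra.
Qed.

(* Up to an error of total mass e, a continuous density is constant on short
   intervals. *)
Lemma almost_uniform mu G e : mu `<< circle_lebesgue R -> lcdf mu G -> 0 < e ->
  exists del V, [/\ 0 < del, {homo V : x y / x <= y}, V 1 - V 0 <= e &
   forall x x' y' y b, 0 <= x <= x' -> x' <= y' <= y -> y < 1 -> y - x <= del ->
     0 <= b <= 1 -> b * (y - x) <= y' - x' ->
     b * (G y - G x) - (V y - V x) <= G y' - G x'].
Proof.
move=> mul muG e0; have [r [r0 ir rE]] := kappa_density mul.
have mr : measurable_fun setT r by have /integrableP[/measurable_EFinP] := ir.
have e4 : 0 < e / 4 by lra.
have leb_itv (u v : R) (b1 b2 : bool) : u <= v ->
    (lebesgue_measure [set` Interval (BSide b1 u) (BSide b2 v)] = (v - u)%:E)%E.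
  move=> uv; apply: (etrans (lebesgue_measure_itv _)); rewrite /= lte_fin.
  by case: ltP => // vu; congr EFin; lra.
have itv01fin : (@lebesgue_measure R `[0%R, 1%R] < +oo)%E by rewrite leb_itv ?ltry.
have [g [gc wle]] : exists g : R -> R, continuous g /\
    (\int[lebesgue_measure]_(z in `[0%R, 1%R]) `|(r z - g z)%:E| < (e / 4)%:E)%E.
  have := @approximation_continuous_integrable R `[0, 1] r (measurable_itv _).
  move=> /(_ itv01fin) h; have [|g_ [gc gi gcv]] := h.
    exact: integrableS ir.
  have /fine_cvgP[hf /cvgrPdist_lt/(_ _ e4) hd] := gcv.
  have [N _ hN] : \forall n \near \oo, (\int[lebesgue_measure]_(z in `[0%R, 1%R]) `|(r z - g_ n z)%:E| < (e / 4)%:E)%E.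
    near=> n; have fn : (\int[lebesgue_measure]_(z in `[0%R, 1%R]) `|(r z - g_ n z)%:E|)%E \is a fin_num by near: n.
    rewrite -(fineK fn) lte_fin; apply: (le_lt_trans (ler_norm _)).
    by rewrite -normrN -sub0r; near: n.
  by exists (g_ N); split => //; exact: (hN N (leqnn N)).
have mg : measurable_fun setT g by exact: continuous_measurable_fun.
(* As the density is nonnegative, replacing g by |g| does not increase the error, and it makes the
   reference constant nonnegative. *)
pose w (z : R) : R := `|r z - `|g z| |.
have mw : measurable_fun setT w.
  apply: measurableT_comp => //; apply: measurable_funB => //.
  exact: measurableT_comp.
have w0 z : 0 <= w z by exact: normr_ge0.
pose n (A : set (measurableTypeR R)) := (\int[lebesgue_measure]_(z in A) (w z)%:E)%E.
pose I01 : set (measurableTypeR R) := `[0%R, 1%R]%classic.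
pose oc (u v : R) : set (measurableTypeR R) := `]u, v]%classic.
have mI01 : measurable I01 by exact: measurable_itv.
have moc u v : measurable (oc u v) by exact: measurable_itv.
have mEw (A : set (measurableTypeR R)) : measurable_fun A (fun z => (w z)%:E).
  by apply/measurable_EFinP; exact: measurable_funS mw.
have wE0 (A : set (measurableTypeR R)) z : A z -> (0 <= (w z)%:E)%E by rewrite lee_fin.
have n01 : (n I01 < (e / 4)%:E)%E.
  apply: le_lt_trans wle; apply: ge0_le_integral => //.
  - by move=> z _; exact: (wE0 setT).
  - apply/measurableT_comp => //; apply/measurable_EFinP; apply: (@measurable_funS _ _ _ _ setT) => //.
    exact: measurable_funB.
  - move=> z _; rewrite lee_fin /w.
    by rewrite -[in leLHS](ger0_norm (r0 z)); exact: ler_dist_dist.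
have nS A B : measurable A -> measurable B -> A `<=` B -> (n A <= n B)%E.
  by move=> mA mB AB; apply: ge0_subset_integral => // z; exact: wE0.
have [del del0 hdel] := segment_unif_continuous gc e4.
(* The distribution function of the error, so that errors on successive intervals telescope. *)
pose N x := fine (n (I01 `&` `]-oo, x])).
have mN x : measurable (I01 `&` `]-oo, x]) by exact: measurableI.
have nge0 A : (0 <= n A)%E by apply: integral_ge0 => z; exact: wE0.
have nfin A : measurable A -> A `<=` I01 -> n A \is a fin_num.
  move=> mA A01; rewrite ge0_fin_numE//; apply: (le_lt_trans (nS _ _ mA mI01 A01)).
  exact: lt_trans n01 (ltry _).
have Nle x y : x <= y -> N x <= N y.
  move=> xy; rewrite /N fine_le ?nfin//.
  by apply: nS => //; apply: setIS => z /=; rewrite !in_itv/= => zx; lra.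
have NB x y : 0 <= x <= y -> y <= 1 -> n (oc x y) = (N y - N x)%:E.
  move=> xy y1; have : n (I01 `&` `]-oo, y]) = (n (I01 `&` `]-oo, x]) + n (oc x y))%E.
    rewrite /n -ge0_integral_setU//.
    - congr integral; apply/seteqP; split => z /=; rewrite /I01 /oc /= !in_itv/=.
        move=> zy; have [xz|zx] := ltP x z; [right; lra|left; split; lra].
      by move=> []; [move=> []|]; split; lra.
    - by move=> z; exact: wE0.
    - by apply/disj_setPS => z /=; rewrite /I01 /oc /= !in_itv/= => -[[]]; lra.
  have f1 : n (oc x y) \is a fin_num.
    by apply: nfin => // z /=; rewrite /I01 /oc /= !in_itv/=; lra.
  rewrite -(fineK (nfin _ (mN y) (@subIsetl _ _ _))) -(fineK (nfin _ (mN x) (@subIsetl _ _ _))).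
  rewrite -(fineK f1) -EFinD => /eqP; rewrite eqe => /eqP; rewrite -/(N x) -/(N y) => ->.
  by congr EFin; lra.
(* The L^1 error is at most e / 4 and counts twice; the oscillation of g on short intervals costs e
   / 2. The total over [0, 1] is at most e. *)
exists del, (fun x => 2 * N x + e / 2 * x); split => //.
- by move=> x y xy; have := Nle _ _ xy; nra.
- have : N 1 <= e / 4.
    rewrite /N -lee_fin fineK ?nfin//; apply: le_trans (ltW n01).
    by apply: nS.
  have : 0 <= N 0 by rewrite /N fine_ge0.
  by lra.
move=> x x' y' y b xx' xy' y1 xyd bb bxy.
set c := `|g x|.
have c0 : 0 <= c by exact: normr_ge0.
have gz z : x <= z <= y -> `| `|g z| - c| <= e / 4.
  move=> xz; rewrite distrC; apply: (le_trans (ler_dist_dist _ _)).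
  by apply: hdel; [lra|rewrite ler_norml; lra].
have leb_cst u v k : u <= v -> (\int[lebesgue_measure]_(z in oc u v) (k%:E) = (k * (v - u))%:E)%E.
  by move=> uv; rewrite integral_cst// EFinM; congr (_ * _)%E; exact: leb_itv.
have mr' (A : set (measurableTypeR R)) : measurable_fun A (fun z => (r z)%:E).
  by apply/measurable_EFinP; exact: measurable_funS mr.
have rE0 (A : set (measurableTypeR R)) z : A z -> (0 <= (r z)%:E)%E by rewrite lee_fin.
have rG u v : 0 <= u <= v -> v < 1 -> (\int[lebesgue_measure]_(z in oc u v) (r z)%:E = (G v - G u)%:E)%E.
  by move=> uv v1; rewrite -rE// (lcdf_kappa_oc muG).
have [/andP[x0 xx1] /andP[xy1 yy1]] := (xx', xy').
have xy0 : 0 <= x' <= y' by rewrite (le_trans x0).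
have x0y : 0 <= x <= y by rewrite x0/= (le_trans xx1)// (le_trans xy1).
have y'1 : y' < 1 by exact: le_lt_trans y1.
have y1' := ltW y1; have y'1' := ltW y'1.
have xyle : x <= y by case/andP: x0y.
have J : c * (y' - x') <= (G y' - G x') + (N y' - N x') + e / 4 * (y' - x').
  rewrite -lee_fin (EFinD (_ + _)) (EFinD (G y' - G x')) -rG//; rewrite -NB//.
  rewrite -!leb_cst//.
  rewrite -ge0_integralD//; [|exact: rE0|exact: wE0].
  rewrite -ge0_integralD//; last 3 first.
  - by move=> z zJ; rewrite adde_ge0// ?lee_fin.
  - exact: emeasurable_funD.
  - by move=> z _; rewrite lee_fin; lra.
  apply: ge0_le_integral => //.
  - by apply: emeasurable_funD => //; exact: emeasurable_funD.
  - move=> z; rewrite /oc/= in_itv/= => zJ; rewrite -!EFinD lee_fin.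
    have := gz z; have := ler_norm (`|g z| - r z).
    by rewrite -(distrC (r z)) -/(w z) ler_norml; lra.
have I : G y - G x <= c * (y - x) + e / 4 * (y - x) + (N y - N x).
  rewrite -lee_fin (EFinD (_ + _)) (EFinD (c * _)) -rG//; rewrite -NB//.
  rewrite -!leb_cst//.
  rewrite -ge0_integralD//; [|by move=> z _; rewrite lee_fin; lra].
  rewrite -ge0_integralD//; last 2 first.
  - by move=> z zJ; rewrite adde_ge0// lee_fin; lra.
  - exact: wE0.
  apply: ge0_le_integral => //.
  - by move=> z; exact: rE0.
  - by apply: emeasurable_funD => //; exact: emeasurable_funD.
  - move=> z; rewrite /oc/= in_itv/= => zJ; rewrite -!EFinD lee_fin.
    have := gz z; have := ler_norm (r z - `|g z|).
    by rewrite -/(w z) ler_norml; lra.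
have NN : 0 <= N y' - N x' <= N y - N x.
  by rewrite subr_ge0 Nle//= lerB// Nle.
have lJ : y' - x' <= y - x by rewrite lerB.
rewrite (_ : 2 * N y + _ - _ = 2 * (N y - N x) + e / 2 * (y - x)); last ring.
exact: (almost_uniform_arith (ltW e0) c0 bb bxy lJ J I NN).
Unshelve. all: by end_near. Qed.

End AbsolutelyContinuous.

(** * Slopes of the invariant distribution function *)

Section InvariantDensity.
Variable R : realType.
Implicit Types (s t u sg La D B : R) (mu : probability (circle R) R) (f p q g G : R -> R) (d : nat).

Lemma is_lift_iter f (Phi : circle R -> circle R) k : is_lift f Phi ->
  is_lift (iter k f) (iter k Phi).
Proof. by move=> fPhi; elim: k => [|k IH] s //=; rewrite fPhi IH. Qed.

Lemma exprn_unbounded La (x : R) : 1 < La -> exists k, x < La ^+ k.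
Proof.
move=> La1; have bern k : 1 + k%:R * (La - 1) <= La ^+ k.
  elim: k => [|k IH]; first by rewrite mul0r addr0 expr0.
  rewrite exprS -natr1; apply: (@le_trans _ _ (La * (1 + k%:R * (La - 1)))).
    have h : 0 <= La - 1 by lra.
    by have := mulr_ge0 (mulr_ge0 (ler0n R k) h) h; lra.
  by rewrite ler_wpM2l//; lra.
exists (Num.truncn (`|x| / (La - 1))).+1; apply: lt_le_trans (bern _).
have := truncnS_gt (`|x| / (La - 1)); rewrite ltr_pdivrMr; last lra.
by have := ler_norm x; lra.
Qed.

(** The error is shared in three: one [ep] for each end of [0, 1] and one for the variation dV. With
    ep = e / (3 E), the factor E restores e. *)
Lemma slope_arith (E b ep e w S g0 g1 G0 G1 dV : R) :
  0 <= E -> 0 <= b -> b <= 1 -> E * b = w -> E * (3 * ep) = e -> 0 <= ep ->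
  g1 = g0 + 1 -> G0 <= g0 + ep -> g1 - ep <= G1 -> dV <= ep ->
  b * (G1 - G0) - dV <= S -> w <= E * S + e.
Proof.
move=> E0 b0 b1 Eb Eep ep0 gE h0 h1 hV hS.
have bG : b * (1 - 2 * ep) <= b * (G1 - G0) by rewrite ler_wpM2l//; lra.
have bep : b * ep <= ep by rewrite ler_piMl.
have /(ler_wpM2l E0) : b - 3 * ep <= S by lra.
by rewrite mulrBr Eb Eep; lra.
Qed.

(** For large k the preimages [x j] of one end of the arc under f^k cut [0, 1) into cells that f^k
    stretches over one turn. By bounded distortion the preimage [x j, y j] of the arc fills at least
    the fraction (t - s) / E of its cell, hence by [almost_uniform] nearly that fraction of its
    mass. Summed over the cells, invariance returns the mass of the arc. *)
Lemma invariant_slope (Phi : circle R -> circle R) f p sg d La D B mu G s t :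
  is_lift f Phi -> sg = 1 \/ sg = -1 -> (forall u, f u = sg * p u) -> (0 < d)%N ->
  expanding_lift p d La D B ->
  mu `<< circle_lebesgue R ->
  (forall k A, measurable A -> mu (iter k Phi @^-1` A) = mu A) ->
  lcdf mu G -> s <= t < s + 1 ->
  t - s <= expR (B / (La - 1)) * (G t - G s).
Proof.
move=> fPhi sgE fE d0 pL mul muinv muG st; set E := expR _.
have [pd La1 _ B0 _] := pL.
have E0 : 0 < E by exact: expR_gt0.
have E1 : 1 <= E by rewrite -expR0 ler_expR divr_ge0//; lra.
apply/ler_addgt0Pr => e e0.
have ep0 : 0 < e / (3 * E) by rewrite divr_gt0// mulr_gt0.
set ep := e / (3 * E) in ep0.
have [del [V [del0 Vle V01 au]]] := almost_uniform mul muG ep0.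
have Gc := lcdf_continuous muG.
have [eta0 /= eta00 c0] : exists2 r, 0 < r & forall u, `|0 - u| < r -> `|G 0 - G u| < ep.
  by have /cvgrPdist_lt/(_ _ ep0)/nbhs_ballP[r /= r0 hr] := Gc 0; exists r.
have [eta1 /= eta10 c1] : exists2 r, 0 < r & forall u, `|1 - u| < r -> `|G 1 - G u| < ep.
  by have /cvgrPdist_lt/(_ _ ep0)/nbhs_ballP[r /= r0 hr] := Gc 1; exists r.
(* Cells have length at most La^-k, which must be below [del] and below the continuity moduli of G
   at 0 and at 1. *)
have [k kdel] := exprn_unbounded (del^-1 + eta0^-1 + eta1^-1) La1.
set L := La ^+ k in kdel.
have L1 : 1 <= L by apply: exprn_ege1; exact: ltW.
have L0 : 0 < L by lra.
have i0 : 0 < del^-1 by rewrite invr_gt0.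
have i1 : 0 < eta0^-1 by rewrite invr_gt0.
have i2 : 0 < eta1^-1 by rewrite invr_gt0.
have Ldel u : L * u <= 1 -> [/\ u < del, u < eta0 & u < eta1].
  move=> Lu; have aux r : 0 < r -> r^-1 < L -> u < r.
    move=> r0 rL; rewrite -(ltr_pM2l L0); apply: le_lt_trans Lu _.
    by rewrite -(mulVf (lt0r_neq0 r0)) ltr_pM2r.
  by split; apply: aux => //; lra.
have [q [sgk [sgkE qE [qd qL qdist]]]] := iter_bounded_distortion k d0 sgE fE pL.
rewrite -/L in qL qdist.
have N0 : (0 < d ^ k)%N by rewrite expn_gt0 d0.
move: (d ^ k)%N N0 qd => N N0 qd.
have [_ qm _] := qd; have [g [qg gq gm _ gD]] := degmap_inv N0 qd.
have qlift := is_lift_iter k fPhi.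
have inv_sum s' t' s1 t1 : s1 <= t1 < s1 + 1 ->
    (forall u, carc s' t' (circle_pi (iter k f u)) <-> carc s1 t1 (circle_pi (q u))) ->
    s' <= t' < s' + 1 ->
    G t' - G s' = \sum_(j < N) (G (g (t1 + j%:R)) - G (g (s1 + j%:R))).
  move=> st1 eqv st'; apply/eqP; rewrite -eqe -muG// -(muinv k); last exact: measurable_carc.
  rewrite (branch_mass N0 qd qg gq gm gD muG st1)// => u.
  by rewrite /= -qlift.
(* The arc is reflected if f^k reverses orientation, then translated by an integer so that the
   points [x j] start inside [0, 1). *)
have [s1 [t1 [w1 s1q Gst]]] : exists s1 t1, [/\ t1 - s1 = t - s, q 0 <= s1 < q 0 + 1 &
    G t - G s = \sum_(j < N) (G (g (t1 + j%:R)) - G (g (s1 + j%:R)))].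
  have fl z : q 0 <= z - (Num.floor (z - q 0))%:~R < q 0 + 1.
    by have /andP[] := floor_itv (z - q 0); rewrite intrD; lra.
  case: sgkE qE => -> qE.
    set m := Num.floor (s - q 0).
    exists (s - m%:~R), (t - m%:~R); split; [lra|exact: fl|].
    apply: inv_sum => //; first lra.
    by move=> u; rewrite qE mul1r -(carcDz (s - _) _ m) !subrK.
  set m := Num.floor (- t - q 0).
  exists (- t - m%:~R), (- s - m%:~R); split; [lra|exact: fl|].
  apply: inv_sum => //; first lra.
  by move=> u; rewrite qE mulN1r circle_piN_carc -(carcDz (- t - _) _ m) !subrK.
(* The last branch is singled out: its cell may leave [0, 1), and only the nonnegativity of its mass
   is used. *)
case: N N0 qd gD Gst {inv_sum} => // N _ qd gD Gst.
pose x j := g (s1 + j%:R); pose y j := g (t1 + j%:R).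
have g0 : g (q 0) = 0 by rewrite qg.
have g1 : g (q 0 + N.+1%:R) = 1.
  by have := gD (q 0) 1; rewrite mulr1z mul1r qg add0r.
have xS j : x j <= x j.+1 by rewrite gm -natr1; lra.
have xy j : x j <= y j by rewrite gm; lra.
have yx j : y j <= x j.+1 by rewrite gm -natr1; lra.
have x0 : 0 <= x 0%N by rewrite -g0 gm; lra.
have x_ge0 j : 0 <= x j by elim: j => // j; move/le_trans; apply.
have x_lt1 j : (j <= N)%N -> x j < 1.
  rewrite -(ler_nat R) => jN; rewrite -g1 (leW_mono gm) -natr1.
  by move: jN; lra.
have Lx j : L * (x j.+1 - x j) <= 1.
  by have := qL _ _ (xS j); rewrite !gq -natr1; lra.
have [_ x0eta _] : [/\ x 0%N < del, x 0%N < eta0 & x 0%N < eta1].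
  by apply: Ldel; have := qL _ _ x0; rewrite gq addr0 subr0; lra.
have [_ _ x1eta] : [/\ 1 - x N < del, 1 - x N < eta0 & 1 - x N < eta1].
  apply: Ldel; have := qL _ _ (ltW (x_lt1 N (leqnn _))).
  rewrite -{2}g1 !gq -natr1; lra.
have G1 : G 1 = G 0 + 1 by have := lcdfD1 0 muG; rewrite add0r.
have Gx0 : G (x 0%N) <= G 0 + ep.
  have := c0 (x 0%N); rewrite sub0r normrN ger0_norm// => /(_ x0eta).
  by rewrite ltr_norml; lra.
have GxN : G 1 - ep <= G (x N).
  have xN1 := x_lt1 N (leqnn _).
  have := c1 (x N); rewrite ger0_norm; last lra.
  by move=> /(_ x1eta); rewrite ltr_norml; lra.
pose b := (t - s) / E.
have ts1 : t - s <= 1 by case/andP: st => _ /ltW; rewrite -lerBlDl.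
have b0 : 0 <= b by rewrite divr_ge0 ?subr_ge0 ?(ltW E0)//; case/andP: st.
have b1 : b <= 1 by rewrite ler_pdivrMr// mul1r (le_trans ts1).
have step j : (j < N)%N ->
    b * (G (x j.+1) - G (x j)) - (V (x j.+1) - V (x j)) <= G (y j) - G (x j).
  move=> jN; apply: au => //.
  - by rewrite x_ge0 lexx.
  - by rewrite xy yx.
  - exact: x_lt1.
  - by have [/ltW] := Ldel _ (Lx j).
  - by rewrite b0 b1.
  - rewrite /b mulrAC ler_pdivrMr//.
    have := qdist (x j) (x j.+1) (x j) (y j) (x j) (x j.+1).
    rewrite !lexx xS xy /= yx => /(_ isT isT isT isT).
    rewrite !gq (_ : s1 + j.+1%:R - (s1 + j%:R) = 1); last by rewrite -natr1; lra.
    move=> /(_ (lexx _)); rewrite mul1r (_ : t1 + j%:R - _ = t - s); last lra.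
    move=> h; apply: (le_trans h); rewrite mulrC ler_wpM2l ?subr_ge0//.
    rewrite ler_expR ler_piMr//; first by rewrite divr_ge0//; lra.
    by rewrite gerBl invr_ge0 ltW.
have xyw : x N <= y N < x N + 1.
  rewrite xy /=; have := qL _ _ (xy N); rewrite !gq => h.
  have : 1 * (y N - x N) <= L * (y N - x N) by rewrite ler_wpM2r// subr_ge0.
  lra.
have last0 := lcdf_nondecreasing muG xyw.
have main : b * (G (x N) - G (x 0%N)) - (V (x N) - V (x 0%N)) <= G t - G s.
  rewrite Gst big_ord_recr/= -[leLHS]addr0 lerD//; last by rewrite subr_ge0.
  rewrite -(telescope_sumr (G \o x) (leq0n N)) -(telescope_sumr (V \o x) (leq0n N)).
  rewrite mulr_sumr -sumrB big_mkord.
  by apply: ler_sum => j _; exact: step.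
have VV : V (x N) - V (x 0%N) <= ep.
  by apply: le_trans V01; rewrite lerB// Vle// ltW// x_lt1.
have Eb : E * b = t - s by rewrite /b mulrCA divff ?mulr1// gt_eqF.
have Eep : E * (3 * ep) = e by rewrite /ep; field; rewrite gt_eqF.
exact: (slope_arith (ltW E0) b0 b1 Eb Eep (ltW ep0) G1 Gx0 GxN VV main).
Qed.

End InvariantDensity.

(** * Cut-off functions *)

Section Cutoff.
Variable R : realType.
Implicit Types (tau x y z : R).

Definition clamp tau x : R := Num.max (- tau) (Num.min tau x).

Lemma max_lip z x y : `|Num.max z x - Num.max z y| <= `|x - y|.
Proof.
wlog yx : x y / y <= x.
  by move=> h; have [|/ltW] := leP y x; [|rewrite distrC (distrC x)]; exact: h.
rewrite (ger0_norm (_ : 0 <= x - y)) ?subr_ge0//.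
by case: (leP z x) => hu; case: (leP z y) => hv; rewrite ler_norml; lra.
Qed.

Lemma min_lip z x y : `|Num.min z x - Num.min z y| <= `|x - y|.
Proof.
wlog yx : x y / y <= x.
  by move=> h; have [|/ltW] := leP y x; [|rewrite distrC (distrC x)]; exact: h.
rewrite (ger0_norm (_ : 0 <= x - y)) ?subr_ge0//.
by case: (leP z x) => hu; case: (leP z y) => hv; rewrite ler_norml; lra.
Qed.

Lemma clamp_lip tau x y : `|clamp tau x - clamp tau y| <= `|x - y|.
Proof. exact: le_trans (max_lip _ _ _) (min_lip _ _ _). Qed.

Lemma clamp_norm_le tau x : 0 <= tau -> `|clamp tau x| <= tau.
Proof.
move=> tau0; rewrite /clamp ler_norml ge_max le_max lexx/= ge_min lexx/= andbT.
by lra.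
Qed.

Lemma clamp_id tau x : `|x| <= tau -> clamp tau x = x.
Proof. by rewrite ler_norml /clamp => /andP[h1 h2]; rewrite (min_idPr h2) (max_idPr h1). Qed.

Lemma clamp_ge tau x : 0 <= tau -> tau <= x -> clamp tau x = tau.
Proof. by move=> t0 tx; rewrite /clamp (min_idPl tx) max_r//; lra. Qed.

Lemma clamp_le tau x : 0 <= tau -> x <= - tau -> clamp tau x = - tau.
Proof. by move=> t0 tx; rewrite /clamp max_l// ge_min tx orbT. Qed.

(* The identity on [[-tau, tau]], and 0 outside [[-2 tau, 2 tau]]. *)
Definition cutoff tau x : R := 2 * clamp tau x - clamp (2 * tau) x.

Lemma cutoff_lip tau x y : `|cutoff tau x - cutoff tau y| <= 3 * `|x - y|.
Proof.
have h1 := clamp_lip tau x y; have h2 := clamp_lip (2 * tau) x y.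
rewrite /cutoff (_ : _ - _ = 2 * (clamp tau x - clamp tau y) -
  (clamp (2 * tau) x - clamp (2 * tau) y)); last by ring.
by apply: (le_trans (ler_normB _ _)); rewrite normrM ger0_norm//; lra.
Qed.

Lemma cutoff_norm_le tau x : 0 <= tau -> `|cutoff tau x| <= 4 * tau.
Proof.
move=> t0; have h1 := clamp_norm_le x t0.
have t2 : 0 <= 2 * tau by lra.
have h2 := clamp_norm_le x t2; rewrite /cutoff.
by apply: (le_trans (ler_normB _ _)); rewrite normrM ger0_norm//; lra.
Qed.

Lemma cutoff_id tau x : `|x| <= tau -> cutoff tau x = x.
Proof.
move=> xt; rewrite /cutoff !clamp_id//; first lra.
by have := normr_ge0 x; lra.
Qed.

Lemma cutoff_out tau x : 0 <= tau -> 2 * tau <= `|x| -> cutoff tau x = 0.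
Proof.
move=> t0; have t2 : 0 <= 2 * tau by lra.
rewrite ler_normr => /orP[h|h]; rewrite /cutoff.
  by rewrite !clamp_ge//; lra.
by rewrite !clamp_le//; lra.
Qed.

Lemma cutoff0 tau : 0 <= tau -> cutoff tau 0 = 0.
Proof. by move=> t0; rewrite cutoff_id// normr0. Qed.

Lemma cutoff_norm_le3 tau x : 0 <= tau -> `|cutoff tau x| <= 3 * `|x|.
Proof. by move=> t0; have := cutoff_lip tau x 0; rewrite cutoff0// !subr0. Qed.

End Cutoff.

(** * Tent functions modulo d *)

Section Bumps.
Variable R : realType.
Implicit Types (x y : R) (d n : nat).

Definition tent_node n (i : nat) : R := i.+1%:R / n.+1%:R.

(** Multiplied by d, this is half the spacing of the nodes, so the supports are disjoint and stay
    inside (0, 1) modulo d. *)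
Definition tent_radius n d : R := (2 * n.+1%:R * d%:R)^-1.

(* [d * circle_dist] between the rescaled points is the distance in R/dZ. *)
Definition tent n d i y : R :=
  Num.max 0 (tent_radius n d - circle_dist (circle_pi (y / d%:R)) (circle_pi (tent_node n i / d%:R))).

Lemma tent_radius_gt0 n d : (0 < d)%N -> 0 < tent_radius n d.
Proof. by move=> d0; rewrite invr_gt0 !mulr_gt0 ?ltr0n. Qed.

Lemma tent_radius_le1 n d : (0 < d)%N -> tent_radius n d <= 1.
Proof.
move=> d0; rewrite invf_le1 ?mulr_gt0 ?ltr0n//.
by rewrite -!natrM ler1n !muln_gt0.
Qed.

Lemma tent_ge0 n d i y : 0 <= tent n d i y.
Proof. by rewrite le_max lexx. Qed.

Lemma tent_le1 n d i y : (0 < d)%N -> tent n d i y <= 1.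
Proof.
move=> d0; rewrite ge_max ler01/=; apply: le_trans (tent_radius_le1 n d0).
by rewrite gerBl circle_dist_ge0.
Qed.

Lemma tentD n d i y : (0 < d)%N -> tent n d i (y + d%:R) = tent n d i y.
Proof.
move=> d0; rewrite /tent mulrDl divff ?circle_piD1//.
by rewrite pnatr_eq0 -lt0n.
Qed.

Lemma tentDz n d i y (m : int) : (0 < d)%N -> tent n d i (y + m%:~R * d%:R) = tent n d i y.
Proof.
move=> d0; rewrite /tent mulrDl mulfK ?circle_piDz//.
by rewrite pnatr_eq0 -lt0n.
Qed.

Lemma tent_lip n d i x y : (0 < d)%N -> `|tent n d i x - tent n d i y| <= `|x - y|.
Proof.
move=> d0; apply: (le_trans (max_lip _ _ _)); rewrite opprB addrC addrA subrK.
rewrite distrC; apply: (le_trans (circle_dist_lipschitz _ _ _)).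
rewrite -mulrBl normrM ler_piMr// ger0_norm ?invr_ge0//.
by rewrite invf_le1 ?ltr0n// ler1n.
Qed.

(** As d >= 2, points of the unit interval are at most 1/2 apart after division by d, so the shorter
    way between them is the direct one. *)
Lemma circle_dist_node n d i y : (1 < d)%N -> 0 < y < 1 -> (i < n)%N ->
  circle_dist (circle_pi (y / d%:R)) (circle_pi (tent_node n i / d%:R)) = `|y - tent_node n i| / d%:R.
Proof.
move=> d1 y01 iN; have d0 : 0 < d%:R :> R by rewrite ltr0n ltnW.
have i01 : 0 < tent_node n i < 1.
  by rewrite divr_gt0 ?ltr0n//= ltr_pdivrMr ?ltr0n// mul1r ltr_nat ltnS.
have yi : `|y - tent_node n i| <= 1 by rewrite ler_norml; lra.
have half : `|y - tent_node n i| / d%:R <= 2^-1.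
  rewrite ler_pdivrMr//; apply: (le_trans yi).
  by rewrite mulrC ler_pdivlMr// mul1r ler_nat.
have e : `|y / d%:R - tent_node n i / d%:R| = `|y - tent_node n i| / d%:R.
  by rewrite -mulrBl normrM (ger0_norm (_ : 0 <= d%:R^-1))// invr_ge0 ltW.
by rewrite circle_distE e ?min_l//; lra.
Qed.

Lemma tent_node_itv n i : (i < n)%N -> n.+1%:R^-1 <= tent_node n i <= 1 - n.+1%:R^-1.
Proof.
move=> iN; have n0 : 0 < n.+1%:R :> R by rewrite ltr0n.
apply/andP; split; first by rewrite /tent_node ler_peMl ?invr_ge0 ?ler1n// ltW.
rewrite /tent_node ler_pdivrMr// mulrBl mul1r mulVf ?gt_eqF//.
by rewrite lerBrDr natr1 ler_nat.
Qed.

Lemma tent_off n d i z : (0 < d)%N ->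
  (forall l : int, n.+1%:R^-1 <= `|z - tent_node n i + l%:~R * d%:R|) -> tent n d i z = 0.
Proof.
move=> d0 h; have dR0 : 0 < d%:R :> R by rewrite ltr0n.
have n0 : 0 < n.+1%:R :> R by rewrite ltr0n.
apply/max_idPl; rewrite subr_le0; apply: le_circle_dist.
move=> s t /circle_pi_eqz[m ->] /circle_pi_eqz[k ->].
have -> : z / d%:R + m%:~R - (tent_node n i / d%:R + k%:~R) =
    (z - tent_node n i + (m - k)%:~R * d%:R) / d%:R.
  by rewrite intrB; field; rewrite gt_eqF.
rewrite normf_div (gtr0_norm dR0) ler_pdivlMr//; apply: le_trans (h _).
rewrite (_ : tent_radius n d * d%:R = n.+1%:R^-1 / 2).
  by rewrite -invr_gt0 in n0; move: (n.+1%:R^-1) n0 => w; lra.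
by rewrite /tent_radius; field; rewrite ?gt_eqF.
Qed.

(** Modulo d >= 2, the translates of (0, 1) by 1 and -1 avoid (0, 1), and the nodes keep distance 1
    / (n + 1) from its ends. *)
Lemma tent_off_unit n d i y : (1 < d)%N -> 0 < y < 1 -> (i < n)%N ->
  tent n d i (y + 1) = 0 /\ tent n d i (y - 1) = 0.
Proof.
move=> d1 y01 /tent_node_itv; have d0 := ltnW d1.
have d2 : 2 <= d%:R :> R by rewrite (ler_nat _ 2).
have dpos (l : int) : 0 <= l -> 0 <= l%:~R * d%:R :> R.
  by move=> l0; rewrite mulr_ge0 ?ler0z.
have dge (l : int) : 1 <= l -> d%:R <= l%:~R * d%:R :> R.
  by rewrite -(ler_int R) => l1; rewrite ler_peMl.
move: (tent_node n i) (n.+1%:R^-1) (@tent_off n d i) => c w off cw.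
split; apply: off => // l; rewrite ler_normr; apply/orP.
  have [l0|l0] := leP 0 l; [left; have := dpos l l0; lra|right].
  have /dge : 1 <= - l by lia.
  by rewrite intrN mulNr; lra.
have [l1|l1] := leP 1 l; [left; have := dge l l1; lra|right].
have /dpos : 0 <= - l by lia.
by rewrite intrN mulNr; lra.
Qed.

Lemma tent_near n d i y : (1 < d)%N -> 0 < y < 1 -> (i < n)%N ->
  `|y - tent_node n i| <= tent_radius n d * d%:R / 2 -> tent_radius n d / 2 <= tent n d i y.
Proof.
move=> d1 y01 iN h; rewrite le_max; apply/orP; right.
have d0 : 0 < d%:R :> R by rewrite ltr0n ltnW.
rewrite circle_dist_node// lerBrDl -lerBrDr ler_pdivrMr//; lra.
Qed.

(** Together with [tent_near], this decouples the coordinates: near node i only the i-th tent is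
    felt. *)
Lemma tent_far n d i j y : (1 < d)%N -> 0 < y < 1 -> (i < n)%N -> (j < n)%N ->
  j != i -> `|y - tent_node n i| <= tent_radius n d * d%:R / 2 -> tent n d j y = 0.
Proof.
move=> d1 y01 iN jN ji h; have d0 : 0 < d%:R :> R by rewrite ltr0n ltnW.
have n0 : 0 < n.+1%:R :> R by rewrite ltr0n.
have rd : tent_radius n d * d%:R = n.+1%:R^-1 / 2.
  by rewrite /tent_radius; field; rewrite ?gt_eqF//.
have ij : n.+1%:R^-1 <= `|tent_node n j - tent_node n i|.
  rewrite /tent_node -mulrBl normrM (ger0_norm (_ : 0 <= n.+1%:R^-1)) ?invr_ge0//.
  rewrite ler_peMl ?invr_ge0// -(intrB _ j.+1 i.+1) normz_ge1// subr_eq0.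
  by rewrite eqz_nat eqSS.
rewrite /tent circle_dist_node//; apply/max_idPl; rewrite subr_le0 ler_pdivlMr//.
have := ler_normB (y - tent_node n i) (y - tent_node n j).
rewrite (_ : _ - (y - tent_node n j) = tent_node n j - tent_node n i); last by ring.
have : 0 < n.+1%:R^-1 :> R by rewrite invr_gt0.
by move: h ij; rewrite rd; move: (n.+1%:R^-1) => w; lra.
Qed.

End Bumps.

(** * The cut-off eigenvectors *)

Section Family.
Variables (R : realType) (Phi : circle R -> circle R) (f p g : R -> R) (sg D : R) (d n : nat).
Hypotheses (fPhi : is_lift f Phi) (sgE : sg = 1 \/ sg = -1)
  (fE : forall u, f u = sg * p u) (d1 : (1 < d)%N) (pd : degmap p d)
  (gp : cancel g p)
  (D1 : 1 <= D) (pD : forall s t, `|p s - p t| <= D * `|s - t|).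
Implicit Types (s t x y : R) (a b : 'rV[R]_n) (i : 'I_n) (j k N : nat).

Let d0 : (0 < d)%N. Proof. exact: ltnW. Qed.
Let dR0 : 0 < d%:R :> R. Proof. by rewrite ltr0n. Qed.
Let D0 : 0 < D. Proof. by apply: lt_le_trans D1. Qed.
Let sg2 : sg * sg = 1. Proof. by case: sgE => ->; lra. Qed.

Let sg_norm : `|sg| = 1. Proof. by case: sgE => ->; rewrite ?normrN normr1. Qed.

(* [p (x + 1) = p x + d] makes this 1-periodic; its sum over the d preimages of a
   point telescopes to 0. *)
Definition wave i x : R := tent n d i (p x) - tent n d i (p x - 1).

Lemma wave_norm_le1 i x : `|wave i x| <= 1.
Proof.
rewrite /wave; move: (tent_ge0 n d i (p x)) (tent_le1 n i (p x) d0).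
move: (tent_ge0 n d i (p x - 1)) (tent_le1 n i (p x - 1) d0).
by move: (tent _ _ _ _) (tent _ _ _ _) => u v u0 u1 v0 v1; rewrite ler_norml; lra.
Qed.

Lemma wave_lip i x y : `|wave i x - wave i y| <= 2 * D * `|x - y|.
Proof.
have h1 := tent_lip n i (p x) (p y) d0.
have h2 := tent_lip n i (p x - 1) (p y - 1) d0.
have e : p x - 1 - (p y - 1) = p x - p y by lra.
rewrite e in h2; rewrite /wave.
rewrite (_ : _ - _ = (tent n d i (p x) - tent n d i (p y)) -
  (tent n d i (p x - 1) - tent n d i (p y - 1))); last by ring.
apply: (le_trans (ler_normB _ _)); rewrite -mulrA mulr2n mulrDl !mul1r.
by apply: lerD; [apply: (le_trans h1)|apply: (le_trans h2)]; exact: pD.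
Qed.

Lemma waveDz i x (m : int) : wave i (x + m%:~R) = wave i x.
Proof. by rewrite /wave (degmapDz _ _ pd) -addrAC !tentDz. Qed.

Lemma wave_iterDz i k x (m : int) : wave i (iter k f (x + m%:~R)) = wave i (iter k f x).
Proof.
have /circle_pi_eqz[m' ->] : circle_pi (iter k f (x + m%:~R)) = circle_pi (iter k f x).
  by rewrite !(is_lift_iter k fPhi) circle_piDz.
exact: waveDz.
Qed.

Lemma wave_iterDn i k x (m : nat) : wave i (iter k f (x + sg * m%:R)) = wave i (iter k f x).
Proof.
case: sgE => ->; first by rewrite mul1r; exact: (wave_iterDz i k x m).
by rewrite mulN1r -(wave_iterDz i k x (- m%:Z)) intrN.
Qed.

Lemma iter_lip k x y : `|iter k f x - iter k f y| <= D ^+ k * `|x - y|.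
Proof.
elim: k => [|k IH] /=; first by rewrite mul1r.
rewrite !fE -mulrBr normrM sg_norm mul1r.
by apply: (le_trans (pD _ _)); rewrite exprS -mulrA ler_wpM2l// ltW.
Qed.

Lemma sum_wave i x : \sum_(m < d) wave i (g (x + m%:R)) = 0.
Proof.
transitivity (\sum_(m < d) (tent n d i (x - 1 + 1 + m%:R) - tent n d i (x - 1 + m%:R))).
  by apply: eq_bigr => m _; rewrite /wave gp subrK (addrAC x).
by rewrite sumrB sum_shift1 tentD// subrr addr0 subrr.
Qed.

(** Against the Lipschitz constant [D^k] of [f^k] this leaves the summable factor [2^-k]. *)
Definition scale k : R := (2 * D) ^- k.

Lemma scale_gt0 k : 0 < scale k.
Proof. by rewrite invr_gt0 exprn_gt0// mulr_gt0. Qed.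

Lemma scale_le j k : (j <= k)%N -> scale k <= scale j.
Proof.
move=> jk; rewrite lef_pV2 ?posrE ?exprn_gt0 ?mulr_gt0//.
by apply: ler_weXn2l => //; have := D1; lra.
Qed.

(* For N large, the j-th transfer of the cut-off eigenvector with parameter a. *)
Definition theta del j N a x : R :=
  del * \sum_(i < n) \sum_(k < N)
    cutoff (scale (k + j)) (a ord0 i) * (sg * d%:R) ^- k * wave i (iter k f x).

Lemma norm_weight k : `|(sg * d%:R) ^- k| = d%:R ^- k.
Proof.
by rewrite normfV normrX normrM sg_norm mul1r gtr0_norm.
Qed.

Lemma weight_le_half k : d%:R ^- k <= 2^-1 ^+ k :> R.
Proof.
rewrite exprVn lef_pV2 ?posrE ?exprn_gt0//.
by rewrite lerXn2r ?nnegrE ?ler0n ?ler_nat.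
Qed.

Lemma sum_half N : \sum_(k < N) (2^-1 ^+ k : R) <= 2.
Proof.
suff -> : \sum_(k < N) (2^-1 ^+ k : R) = 2 - 2 * 2^-1 ^+ N.
  by have := exprn_ge0 N (ltW (_ : 0 < 2^-1 :> R)); rewrite invr_gt0 ltr0n => /(_ isT); lra.
elim: N => [|N IH]; first by rewrite big_ord0 expr0; lra.
by rewrite big_ord_recr/= IH exprS; lra.
Qed.

Lemma geometric_bound N (F : 'I_n -> 'I_N -> R) (c : 'I_n -> R) :
  (forall i, 0 <= c i) ->
  (forall i (k : 'I_N), `|F i k| <= c i * 2^-1 ^+ k) ->
  `|\sum_(i < n) \sum_(k < N) F i k| <= 2 * \sum_(i < n) c i.
Proof.
move=> c0 Fc; apply: (le_trans (ler_norm_sum _ _ _)); rewrite mulr_sumr.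
apply: ler_sum => i _; apply: (le_trans (ler_norm_sum _ _ _)).
apply: (@le_trans _ _ (\sum_(k < N) c i * 2^-1 ^+ k)).
  by apply: ler_sum => k _; exact: Fc.
by rewrite -mulr_sumr mulrC ler_wpM2r// sum_half.
Qed.

(** The k-th term has constant at most 4 (2 D)^-k * 2 D * D^k = 8 D 2^-k, and the powers of 1/2 sum
    to at most 2. *)
Lemma theta_lip del j N a x y : 0 <= del ->
  `|theta del j N a x - theta del j N a y| <= del * (16 * D * n%:R) * `|x - y|.
Proof.
move=> del0; rewrite /theta -mulrBr normrM (ger0_norm del0) -mulrA ler_wpM2l//.
rewrite -sumrB; under eq_bigr do rewrite -sumrB.
have c0 : 0 <= 8 * D * `|x - y| by rewrite !mulr_ge0// ltW.
apply: (le_trans (@geometric_bound N _ (fun=> 8 * D * `|x - y|) (fun=> c0) _)).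
  move=> i k; rewrite -mulrBr !normrM norm_weight.
  have h1 := cutoff_norm_le (a ord0 i) (ltW (scale_gt0 (k + j))).
  have h2 : scale (k + j) <= scale k by apply: scale_le; exact: leq_addr.
  have h3 := le_trans (wave_lip i (iter k f x) (iter k f y))
     (ler_wpM2l (mulr_ge0 (ler0n R 2) (ltW D0)) (iter_lip k x y)).
  have h4 : d%:R ^- k <= 1 :> R.
    by rewrite invf_le1 ?exprn_gt0// exprn_ege1// ler1n.
  have s0 := scale_gt0 k.
  have h5 : `|cutoff (scale (k + j)) (a ord0 i)| * d%:R ^- k <= 4 * scale k * 1.
    by apply: ler_pM => //; apply: (le_trans h1); lra.
  apply: (@le_trans _ _ (4 * scale k * 1 * (2 * D * (D ^+ k * `|x - y|)))).
    by apply: ler_pM => //; rewrite mulr_ge0// invr_ge0 exprn_ge0.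
  rewrite le_eqVlt; apply/orP; left; apply/eqP.
  have Dk : D ^+ k != 0 by rewrite expf_neq0// gt_eqF.
  by rewrite /scale exprMn exprVn; field; rewrite Dk expf_neq0.
by rewrite sumr_const card_ord -mulr_natr; lra.
Qed.

(** In sup norm the weights d^-k <= 2^-k give the convergence. The 3 is the Lipschitz constant of
    the cut-off, which makes the bound uniform in the heights. *)
Lemma theta_sub_le del j N a b x : 0 <= del ->
  `|theta del j N a x - theta del j N b x| <= del * (6 * \sum_(i < n) `|a ord0 i - b ord0 i|).
Proof.
move=> del0; rewrite /theta -mulrBr normrM (ger0_norm del0) ler_wpM2l//.
rewrite -sumrB; under eq_bigr do rewrite -sumrB.
have c0 i : 0 <= 3 * `|a ord0 i - b ord0 i| by rewrite mulr_ge0.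
apply: (le_trans (@geometric_bound N _ _ c0 _)).
  move=> i k; rewrite -!mulrBl !normrM norm_weight -mulrA ler_pM//.
  - exact: cutoff_lip.
  - rewrite -[leRHS]mulr1 ler_pM//; first exact: weight_le_half.
    exact: wave_norm_le1.
by rewrite -mulr_sumr mulrA (_ : 2 * 3 = 6)//; lra.
Qed.

Lemma sum_half_tail M N :
  \sum_(k < N) (if (k <= M)%N then 0 else 2^-1 ^+ k : R) <= 2^-1 ^+ M.
Proof.
(* The exact value carries the induction; N.-1 is the last index of the sum. *)
suff : \sum_(k < N) (if (k <= M)%N then 0 else 2^-1 ^+ k : R) =
    2^-1 ^+ M - 2^-1 ^+ maxn N.-1 M.
  by move=> ->; rewrite gerBl exprn_ge0// invr_ge0.
elim: N => [|N IH]; first by rewrite big_ord0 max0n subrr.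
rewrite big_ord_recr/= IH; case: leqP => NM.
  by rewrite addr0 (maxn_idPr (leq_trans (leq_pred N) NM)).
case: N NM {IH} => // N NM; rewrite (maxn_idPl _)//.
by rewrite exprS; lra.
Qed.

Lemma geometric_tail_bound M N (F : 'I_n -> 'I_N -> R) (c : 'I_n -> R) :
  (forall i, 0 <= c i) ->
  (forall i (k : 'I_N), `|F i k| <= c i * (if (k <= M)%N then 0 else 2^-1 ^+ k)) ->
  `|\sum_(i < n) \sum_(k < N) F i k| <= 2^-1 ^+ M * \sum_(i < n) c i.
Proof.
move=> c0 Fc; apply: (le_trans (ler_norm_sum _ _ _)); rewrite mulr_sumr.
apply: ler_sum => i _; apply: (le_trans (ler_norm_sum _ _ _)).
apply: (@le_trans _ _ (\sum_(k < N) c i * (if (k <= M)%N then 0 else 2^-1 ^+ k))).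
  by apply: ler_sum => k _; exact: Fc.
by rewrite -mulr_sumr mulrC ler_wpM2r// sum_half_tail.
Qed.

(** For k <= M both cut-offs act as the identity and the terms cancel. Each later term is at most 6
    |a_i| 2^-k, as either cut-off at most triples |a_i|. *)
Lemma theta_shift_le del j M N a x : 0 <= del ->
  (forall i, `|a ord0 i| <= scale (M + j)) ->
  `|theta del 0 N a x - theta del j N a x| <=
    del * (6 * 2^-1 ^+ M * \sum_(i < n) `|a ord0 i|).
Proof.
move=> del0 aM; rewrite /theta -mulrBr normrM (ger0_norm del0) ler_wpM2l//.
rewrite -sumrB; under eq_bigr do rewrite -sumrB.
have c0 i : 0 <= 6 * `|a ord0 i| by rewrite mulr_ge0.
apply: (le_trans (@geometric_tail_bound M N _ _ c0 _)).
  move=> i k; rewrite -!mulrBl !normrM norm_weight -mulrA addn0; case: leqP => kM.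
    rewrite !cutoff_id ?subrr ?normr0 ?mul0r ?mulr0//.
    - by apply: (le_trans (aM i)); apply: scale_le; rewrite leq_add2r.
    - by apply: (le_trans (aM i)); apply: scale_le; exact: leq_trans (leq_addr _ _).
  rewrite ler_pM//.
    apply: (le_trans (ler_normB _ _)).
    have h1 := cutoff_norm_le3 (a ord0 i) (ltW (scale_gt0 k)).
    have h2 := cutoff_norm_le3 (a ord0 i) (ltW (scale_gt0 (k + j))).
    by lra.
  rewrite -[leRHS]mulr1 ler_pM//; first exact: weight_le_half.
  exact: wave_norm_le1.
by rewrite -mulr_sumr mulrA (mulrC _ 6).
Qed.

Lemma cutoff_stable x : exists N0, forall k, (N0 <= k)%N -> cutoff (scale k) x = 0.
Proof.
have [->|x0] := eqVneq x 0; first by exists 0%N => k _; rewrite cutoff0// ltW// scale_gt0.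
have D2 : 1 < 2 * D by have := D1; lra.
have [N0 hN] := exprn_unbounded (2 / `|x|) D2.
exists N0 => k Nk; apply: cutoff_out; first by rewrite ltW// scale_gt0.
have x0' : 0 < `|x| by rewrite normr_gt0.
apply: (@le_trans _ _ (2 * scale N0)); first by rewrite ler_wpM2l// scale_le.
rewrite /scale ler_pdivrMr ?exprn_gt0 ?mulr_gt0// mulrC.
by move: hN; rewrite ltr_pdivrMr// => /ltW.
Qed.

(** The cut-off vanishes once its height is below |a_i| / 2, so the series is a finite sum. The
    number of terms depends on [a] alone, as a shift by j only lowers the heights. *)
Lemma theta_stable a : exists N0, forall del j N x, (N0 <= N)%N ->
  theta del j N a x = theta del j N0 a x.
Proof.
have [N1 N1P] := choice (fun i : 'I_n => cutoff_stable (a ord0 i)).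
exists (\max_i N1 i) => del j N x NN; congr (_ * _); apply: eq_bigr => i _.
rewrite -(subnKC NN); elim: (N - _)%N => [|m IH]; first by rewrite addn0.
rewrite addnS big_ord_recr/= IH N1P ?mul0r ?addr0//.
by rewrite -addnA (leq_trans (leq_bigmax i))// leq_addr.
Qed.

(** The term k = 0 is killed by [sum_wave]. In a later term f (g (sg t + m)) = t + sg m, so the d
    branches contribute equally and the factor sg d lowers the exponent by one. The heights are
    unchanged, because k + 1 + j = k + (j + 1). *)
Lemma transfer_theta del j N a t :
  transfer sg g d (theta del j N.+1 a) t = theta del j.+1 N a t.
Proof.
rewrite /transfer /theta -mulr_sumr mulrCA; congr (_ * _).
rewrite exchange_big/= mulr_sumr; apply: eq_bigr => i _.
rewrite exchange_big/= mulr_sumr big_ord_recl/= -mulr_sumr sum_wave !mulr0 add0r.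
apply: eq_bigr => k _; rewrite /bump/= add1n -mulr_sumr addSnnS.
rewrite (eq_bigr (fun=> wave i (iter k f t))); last first.
  by move=> m _; rewrite -iterS iterSr fE gp mulrDr mulrA sg2 mul1r wave_iterDn.
rewrite sumr_const card_ord -(mulr_natr (wave _ _) d).
have sgd : sg * d%:R != 0 by rewrite -normr_eq0 normrM sg_norm mul1r normr_nat gt_eqF.
have -> : (sg * d%:R) ^- k = (sg * d%:R) * (sg * d%:R) ^- k.+1.
  by rewrite exprS invfM mulrA divff// mul1r.
by ring.
Qed.

Lemma theta_branch del N a y : (0 < N)%N -> 0 < y < 1 ->
  (forall i, `|a ord0 i| <= 1) ->
  theta del 0 N a (g (y + 1)) - theta del 0 N a (g y) =
    - 2 * del * \sum_(i < n) a ord0 i * tent n d i y.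
Proof.
case: N => // N _ y01 a1.
rewrite /theta -mulrBr (mulrC (- 2)) -mulrA; congr (_ * _).
rewrite -sumrB mulr_sumr; apply: eq_bigr => i _.
rewrite -sumrB big_ord_recl/= [X in _ + X]big1 ?addr0; last first.
  move=> k _; rewrite -mulrBr -!iterS !iterSr !fE !gp.
  have := wave_iterDn i k (sg * y) 1; rewrite mulr1 -{2}[sg]mulr1 -mulrDr => ->.
  by rewrite subrr mulr0.
rewrite expr0 invr1 mulr1 -mulrBr cutoff_id; last by rewrite /scale expr0 invr1.
(* The wave equals minus the tent at g (y + 1) and plus the tent at g y, whence the factor -2. *)
rewrite /wave !gp addrK; have [-> ->] := tent_off_unit d1 y01 (ltn_ord i).
by ring.
Qed.

End Family.

(** * Lower bound for W by separating arcs *)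

Section WassersteinLowerBound.
Variable R : realType.
Implicit Types (s t u v y a b D eta : R) (nu mu : probability (circle R) R) (p g : R -> R) (d : nat).

(* [p] modulo d, with values in [0, d). *)
Definition branch_coord p d (x : circle R) : R := d%:R * kappa (circle_pi (p (kappa x) / d%:R)).

Lemma measurable_branch_coord p d : continuous p ->
  measurable_fun setT (branch_coord p d : circle R -> measurableTypeR R).
Proof.
move=> pc; have mk := @measurable_kappa R.
apply: measurable_funM => //; apply: (measurableT_comp mk).
apply: (measurableT_comp (@circle_pi_measurable R)); apply: measurable_funM => //.
by apply: measurableT_comp mk; exact: continuous_measurable_fun.
Qed.

Lemma branch_coordE p d u : (0 < d)%N -> degmap p d ->
  exists m : int, branch_coord p d (circle_pi u) = p u + m%:~R * d%:R.
Proof.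
move=> d0 pd; have dn0 : d%:R != 0 :> R by rewrite pnatr_eq0 -lt0n.
rewrite /branch_coord !kappa_pi /fracp -intrN (degmapDz _ _ pd).
set k := Num.floor _; set l := Num.floor _.
exists (- k - l); rewrite intrB !intrN; field.
by [].
Qed.

Lemma branch_coord_itv p d x : (0 < d)%N -> 0 <= branch_coord p d x < d%:R.
Proof.
move=> d0; have dn0 : 0 < d%:R :> R by rewrite ltr0n.
by rewrite mulr_ge0 ?kappa_ge0 ?ler0n//= -[ltRHS]mulr1 ltr_pM2l// kappa_lt1.
Qed.

Lemma norm_sub_le (x y w : R) : x <= w + y -> y <= w + x -> `|x - y| <= w.
Proof. by move=> xy yx; rewrite ler_norml; lra. Qed.

Lemma max_sub_min (x y : R) : Num.max x y - Num.min x y <= `|x - y|.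
Proof. by case: (leP x y) => xy; [rewrite distrC|]; exact: ler_norm. Qed.

Lemma mul2_le_sqr (x y : R) : 2 * x * y <= x ^+ 2 + y ^+ 2.
Proof. by have := sqr_ge0 (x - y); rewrite sqrrB; lra. Qed.

Lemma int_mul_small (m : int) (c : R) : 0 < c -> - c < m%:~R * c < c -> m = 0.
Proof.
move=> c0 h; have : -1 < (m%:~R : R) < 1.
  by rewrite -(ltr_pM2r c0) -[_ < 1](ltr_pM2r c0) mulN1r mul1r.
rewrite -[X in _ < _ < X]/((1%:Z)%:~R) -[X in X < _ < _]/((-1%:Z)%:~R) !ltr_int.
by lia.
Qed.

(** [y, y + 1] fits into [0, d) since y < 1 and d >= 2. Describing the arcs by one real coordinate
    makes membership jointly measurable in y and x. *)
Lemma branch_carcE p d g y : (1 < d)%N -> degmap p d -> cancel p g -> cancel g p ->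
  0 < y < 1 ->
  carc (g y) (g (y + 1)) = [set x | y <= branch_coord p d x <= y + 1].
Proof.
move=> d1 pd pg gp y01; have [_ pm _] := pd; have d0 := ltnW d1.
have d2 : 2 <= d%:R :> R by rewrite (ler_nat _ 2).
have mono a b u : (g a <= u <= g b) = (a <= p u <= b).
  by rewrite -(pm (g a)) -(pm u) !gp.
apply/seteqP; split => x; have [u <-] := circle_pi_surj x => /=.
  move=> /carc_pi[m]; rewrite mono (degmapDz _ _ pd) => h.
  have [k kE] := branch_coordE u d0 pd; have := branch_coord_itv p (circle_pi u) d0.
  rewrite kE => h2.
  suff -> : k = m by [].
  have dR : 0 < d%:R :> R by rewrite ltr0n.
  apply/eqP; rewrite -subr_eq0; apply/eqP; apply: (int_mul_small dR).
  by rewrite intrB; lra.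
have [k ->] := branch_coordE u d0 pd => h; apply/carc_pi; exists k.
by rewrite mono (degmapDz _ _ pd).
Qed.

(** One of the two ends y and y + 1, translated by a multiple of d, lies between p s and p t, and
    both ends project to the same point of the circle. *)
Lemma coord_separation p d y s t : (0 < d)%N -> degmap p d ->
  y <= branch_coord p d (circle_pi s) <= y + 1 ->
  ~ (y <= branch_coord p d (circle_pi t) <= y + 1) -> 0 < y < 1 -> (1 < d)%N ->
  carc (Num.min (p s) (p t)) (Num.max (p s) (p t)) (circle_pi y).
Proof.
move=> d0 pd ys yt y01 d1.
have d2 : 2 <= d%:R :> R by rewrite (ler_nat _ 2).
have [m mE] := branch_coordE s d0 pd; have [k kE] := branch_coordE t d0 pd.
have yt' : ~ (y <= p t + m%:~R * d%:R <= y + 1).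
  move=> h; apply: yt; rewrite kE; have := branch_coord_itv p (circle_pi t) d0.
  rewrite kE => h2.
  suff -> : k = m by [].
  have dR : 0 < d%:R :> R by rewrite ltr0n.
  apply/eqP; rewrite -subr_eq0; apply/eqP; apply: (int_mul_small dR).
  by rewrite intrB; lra.
rewrite mE in ys; apply/carc_pi.
have [h|h] := ltP (p t + m%:~R * d%:R) y.
  exists (- (m * d%:Z)); rewrite intrN intrM -[d%:~R]/(d%:R).
  by rewrite ge_min le_max; apply/andP; split; apply/orP; [right|left]; lra.
have h' : y + 1 < p t + m%:~R * d%:R.
  by rewrite ltNge; apply/negP => h'; apply: yt'; rewrite h h'.
exists (1 - m * d%:Z); rewrite intrB intrM -[d%:~R]/(d%:R).
by rewrite ge_min le_max; apply/andP; split; apply/orP; [left|right]; lra.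
Qed.

Lemma branch_width p d g y : (1 < d)%N -> degmap p d -> cancel p g -> cancel g p ->
  g y <= g (y + 1) < g y + 1.
Proof.
move=> d1 pd pg gp; have [_ pm pD] := pd.
have d2 : 2 <= d%:R :> R by rewrite (ler_nat _ 2).
have gm : {mono g : s t / s <= t} by move=> s t; rewrite -pm !gp.
rewrite gm -(leW_mono pm) pD !gp; lra.
Qed.

Lemma lebesgue_preimage_carc u v (A : set (measurableTypeR R)) :
  measurable A -> A `<=` `[0, 1] -> A `<=` @circle_pi R @^-1` (carc u v) -> u <= v ->
  (lebesgue_measure A <= (v - u)%:E)%E.
Proof.
move=> mA A01 Auv uv.
have le01 : (lebesgue_measure A <= 1%:E)%E.
  apply: (@le_trans _ _ (lebesgue_measure (`[0, 1]%classic : set (measurableTypeR R)))).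
    by apply: le_measure; rewrite ?inE//; exact: measurable_itv.
  rewrite le_eqVlt; apply/orP; left; apply/eqP.
  by apply: (etrans (lebesgue_measure_itv `[0, 1])); rewrite /= lte_fin ltr01 sube0.
have [uv1|uv1] := leP (u + 1) v.
  by apply: (le_trans le01); rewrite lee_fin; lra.
have muv : measurable (carc u v) by apply: measurable_carc; lra.
rewrite -(@lcdf_lebesgue R u v); last lra.
rewrite /circle_lebesgue /distribution /pushforward/=.
have mP : measurable (@circle_pi R @^-1` (carc u v) : set (measurableTypeR R)).
  by rewrite -[X in measurable X]setTI; exact: circle_pi_measurable.
rewrite uniform_prob01E//; apply: le_measure; rewrite ?inE//.
  by apply: measurableI => //; exact: measurable_itv.
by move=> x Ax; split; [exact: Auv|exact: A01].
Qed.

(* A point y separates the branches of x and x' only if y mod 1 lies between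
   [p x] and [p x']. Integrating over y and then over a coupling (Tonelli) turns the
   mass defects of the arcs into a lower bound on the mean displacement. *)
Lemma W_ge_branch p d g D nu mu a b eta : (1 < d)%N -> degmap p d ->
  cancel p g -> cancel g p -> 0 < D -> (forall s t, `|p s - p t| <= D * `|s - t|) ->
  0 <= a < b -> b <= 1 -> 0 <= eta -> coupling nu mu !=set0 ->
  (forall y, a < y < b ->
    exists r1 r2, [/\ nu (carc (g y) (g (y + 1))) = r1%:E,
      mu (carc (g y) (g (y + 1))) = r2%:E & eta <= `|r1 - r2|]) ->
  eta * (b - a) / D <= W nu mu.
Proof.
move=> d1 pd pg gp D0 pL ab b1 eta0 cn etaP; have d0 := ltnW d1; have [pc pm _] := pd.
set w := eta * (b - a) / D.
have w0 : 0 <= w by rewrite divr_ge0 ?mulr_ge0//; lra.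
have d2 : 2 <= d%:R :> R by rewrite (ler_nat _ 2).
apply: W_ge => // Pi cPi.
have mdist := @measurable_circle_dist2 R.
have dist1 (z : circle R * circle R) : circle_dist z.1 z.2 <= 1.
  case: z => x x' /=; rewrite -(kappaK x) -(kappaK x'); apply: (le_trans (circle_dist_le _ _)).
  have := kappa_ge0 x; have := kappa_lt1 x; have := kappa_ge0 x'; have := kappa_lt1 x'.
  by rewrite ler_norml; lra.
have distE0 (z : circle R * circle R) : setT z -> (0 <= (circle_dist z.1 z.2)%:E)%E.
  by rewrite lee_fin circle_dist_ge0.
have fin : (\int[Pi]_z (circle_dist z.1 z.2 ^+ 2)%:E < +oo)%E.
  apply: (@le_lt_trans _ _ (\int[Pi]_z (cst 1%:E z))%E).
    apply: ge0_le_integral => // [z _|z _]; first by rewrite lee_fin sqr_ge0.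
    by rewrite lee_fin expr_le1// circle_dist_ge0.
  by rewrite integral_cst// mul1e (le_lt_trans (probability_le1 _ _)) ?ltry.
rewrite fin andbT.
pose X := (measurableTypeR R * (circle R * circle R))%type.
pose phi := branch_coord p d.
have mphi := @measurable_branch_coord p d pc.
have mT (k : X -> circle R) : measurable_fun setT k ->
    measurable [set z : X | z.1 <= phi (k z) <= z.1 + 1].
  move=> mk; rewrite (_ : [set _ | _] = [set z : X | z.1 <= phi (k z)] `&`
      [set z : X | phi (k z) <= z.1 + 1]); last first.
    by apply/seteqP; split => z /= => [/andP[]|[-> ->]].
  have m1 : measurable_fun setT (fun z : X => z.1) by exact: measurable_fst.
  have mpk : measurable_fun setT (fun z : X => phi (k z) : measurableTypeR R).
    exact: measurableT_comp mphi mk.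
  apply: measurableI; rewrite -[X in measurable X]setTI.
    exact: (@measurable_fun_le _ _ _ setT).
  by apply: (@measurable_fun_le _ _ _ setT) => //; exact: measurable_funD.
pose B1 := [set z : X | z.1 <= phi z.2.1 <= z.1 + 1].
pose B2 := [set z : X | z.1 <= phi z.2.2 <= z.1 + 1].
pose Y := [set z : X | a < z.1 < b].
have mB1 : measurable B1.
  by apply: mT; apply: (measurableT_comp measurable_fst); exact: measurable_snd.
have mB2 : measurable B2.
  by apply: mT; apply: (measurableT_comp measurable_snd); exact: measurable_snd.
have m1 : measurable_fun setT (fun z : X => z.1) by exact: measurable_fst.
have mY : measurable Y.
  rewrite (_ : Y = ~` [set z : X | z.1 <= a] `&` ~` [set z : X | b <= z.1]); last first.
    apply/seteqP; split => z; rewrite /Y /= !ltNge; first by case/andP => /negP ? /negP.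
    by case=> /negP -> /negP ->.
  apply: measurableI; apply: measurableC; rewrite -[X in measurable X]setTI.
    exact: (@measurable_fun_le _ _ _ setT).
  exact: (@measurable_fun_le _ _ _ setT).
(* The triples (y, x, x') for which the arc of y contains exactly one of x and x'. *)
pose S := Y `&` ((B1 `\` B2) `|` (B2 `\` B1)).
have mS : measurable S by apply: measurableI => //; apply: measurableU; exact: measurableD.
pose F z := (\1_S z : R)%:E.
have mF : measurable_fun setT F by apply/measurable_EFinP; exact: measurable_indic.
have F0 z : (0 <= F z)%E by rewrite lee_fin.
have tonelli := @fubini_tonelli _ _ _ _ _ (@lebesgue_measure R) Pi F mF F0.
(* If x lies in the arc, then either x' does too or the pair is separated; comparing the two
   marginals bounds the mass defect by the separated mass. *)
have Pi_ge y : a < y < b -> (eta%:E <= Pi (xsection S y))%E.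
  move=> yab; have [r1 [r2 [nuB muB r12]]] := etaP y yab.
  have y01 : 0 < y < 1 by lra.
  set B := carc _ _ in nuB muB.
  have mB : measurable B by rewrite /B; exact: measurable_carc (branch_width y d1 pd pg gp).
  have [PB1 PB2] := cPi _ mB.
  have mx : measurable (xsection S y) by exact: measurable_xsection.
  have mB1T : measurable (B `*` @setT (circle R)) by exact: measurableX.
  have mTB2 : measurable (@setT (circle R) `*` B) by exact: measurableX.
  have BE x : B x <-> y <= phi x <= y + 1 by rewrite /B (branch_carcE d1 pd pg gp y01).
  have le1 : (r1%:E <= Pi (xsection S y) + r2%:E)%E.
    rewrite -nuB -muB -PB1 -PB2; apply: le_trans (measureU2 _ mx mTB2).
    apply: le_measure; rewrite ?inE//; first exact: measurableU.
    move=> [x x'] /= [/BE Bx _]; have [Bx'|Bx'] := pselect (B x'); [by right|left].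
    rewrite /xsection /= inE; split => //; left; split => //= h.
    by apply: Bx'; apply/BE.
  have le2 : (r2%:E <= Pi (xsection S y) + r1%:E)%E.
    rewrite -nuB -muB -PB1 -PB2; apply: le_trans (measureU2 _ mx mB1T).
    apply: le_measure; rewrite ?inE//; first exact: measurableU.
    move=> [x x'] /= [_ /BE Bx']; have [Bx|Bx] := pselect (B x); [by right|left].
    rewrite /xsection /= inE; split => //; right; split => //= h.
    by apply: Bx; apply/BE.
  have fx : Pi (xsection S y) \is a fin_num by exact: fin_num_measure.
  move: le1 le2; rewrite -(fineK fx) -!EFinD !lee_fin => le1 le2.
  exact: (le_trans r12 (norm_sub_le le1 le2)).
have low : ((eta * (b - a))%:E <= \int[lebesgue_measure]_y \int[Pi]_z F (y, z))%E.
  have FE y : (\int[Pi]_z F (y, z) = Pi (xsection S y))%E.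
    rewrite -[xsection S y]setIT -integral_indic//; last exact: measurable_xsection.
    by apply: eq_integral => z _; rewrite /F !indicE mem_xsection.
  have mF1 : measurable_fun setT (fun y : measurableTypeR R => (\int[Pi]_z F (y, z))%E).
    exact: measurable_fun_fubini_tonelli_F.
  have -> : ((eta * (b - a))%:E = \int[lebesgue_measure]_(y in `]a, b[) (cst eta%:E y))%E.
    rewrite integral_cst// EFinM; congr (_ * _)%E; apply/esym.
    apply: (etrans (lebesgue_measure_itv _)); rewrite /= lte_fin.
    by have /andP[_ ->] := ab.
  apply: (@le_trans _ _ (\int[lebesgue_measure]_(y in `]a, b[) \int[Pi]_z F (y, z))%E).
    apply: ge0_le_integral => //.
    - exact: measurable_funS mF1.
    - by move=> y; rewrite /= in_itv/= => yab; rewrite FE Pi_ge.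
  apply: ge0_subset_integral => // y _; exact: integral_ge0.
(* The bound D |s - t| is shown for each pair of lifts, and only then the infimum over lifts is
   taken. *)
have leb_le z : (lebesgue_measure (ysection S z) <= (D * circle_dist z.1 z.2)%:E)%E.
  have my : measurable (ysection S z) by exact: measurable_ysection.
  have S01 : ysection S z `<=` `[0, 1].
    move=> y; rewrite /ysection /= inE => -[yab _]; have {}yab : a < y < b := yab.
    by rewrite /= in_itv/=; lra.
  have sep s t y : circle_pi s = z.1 -> circle_pi t = z.2 -> ysection S z y ->
      carc (Num.min (p s) (p t)) (Num.max (p s) (p t)) (circle_pi y).
    move=> sz tz; rewrite /ysection /= inE => -[yab]; have {}yab : a < y < b := yab.
    have y01 : 0 < y < 1 by lra.
    move=> [[/= h1 h2]|[/= h2 h1]].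
      by apply: (coord_separation d0 pd) => //; rewrite ?sz ?tz.
    by rewrite minC maxC; apply: (coord_separation d0 pd) => //; rewrite ?sz ?tz.
  have le_st s t : circle_pi s = z.1 -> circle_pi t = z.2 ->
      (lebesgue_measure (ysection S z) <= (D * `|s - t|)%:E)%E.
    move=> sz tz; apply: (@le_trans _ _ (Num.max (p s) (p t) - Num.min (p s) (p t))%:E).
      apply: lebesgue_preimage_carc => // [y Sy|]; first exact: sep.
      by rewrite ge_min le_max lexx.
    rewrite lee_fin; apply: le_trans (pL s t).
    exact: max_sub_min.
  have fy : lebesgue_measure (ysection S z) \is a fin_num.
    have [[s sz] [t tz]] := (circle_pi_surj z.1, circle_pi_surj z.2).
    by rewrite ge0_fin_numE// (le_lt_trans (le_st _ _ sz tz))// ltry.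
  rewrite -(fineK fy) lee_fin mulrC -ler_pdivrMr//.
  apply: le_circle_dist => s t sz tz; rewrite ler_pdivrMr// mulrC -lee_fin fineK//.
  exact: le_st.
have mdE : measurable_fun setT (fun z : circle R * circle R => (circle_dist z.1 z.2)%:E).
  by apply/measurable_EFinP; exact: measurable_circle_dist.
have up : (\int[Pi]_z \int[lebesgue_measure]_y F (y, z) <= D%:E * \int[Pi]_z (circle_dist z.1 z.2)%:E)%E.
  rewrite -ge0_integralZl_EFin//; last by lra.
  apply: ge0_le_integral => //.
  - by move=> z _; apply: integral_ge0.
  - exact: measurable_fun_fubini_tonelli_G.
  - exact: measurable_funeM.
  - move=> z _; rewrite -EFinM; apply: le_trans (leb_le z).
    rewrite -[ysection S z]setIT -integral_indic//; last exact: measurable_ysection.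
    rewrite le_eqVlt; apply/orP; left; apply/eqP.
    by apply: eq_integral => y _; rewrite /F !indicE mem_ysection.
have key : ((eta * (b - a))%:E <= D%:E * \int[Pi]_z (circle_dist z.1 z.2)%:E)%E.
  by apply: le_trans low _; rewrite tonelli.
have I1fin : (\int[Pi]_z (circle_dist z.1 z.2)%:E)%E \is a fin_num.
  rewrite ge0_fin_numE ?integral_ge0//.
  apply: (@le_lt_trans _ _ (\int[Pi]_z (cst 1%:E z))%E).
    by apply: ge0_le_integral => // z _; rewrite lee_fin.
  by rewrite integral_cst// mul1e (le_lt_trans (probability_le1 _ _)) ?ltry.
have I2fin : (\int[Pi]_z (circle_dist z.1 z.2 ^+ 2)%:E)%E \is a fin_num.
  by rewrite ge0_fin_numE// integral_ge0// => z _; rewrite lee_fin sqr_ge0.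
(* [2 w x <= w ^ 2 + x ^ 2] replaces the Cauchy-Schwarz inequality. *)
have young : ((2 * w)%:E * \int[Pi]_z (circle_dist z.1 z.2)%:E <=
    (w ^+ 2)%:E + \int[Pi]_z (circle_dist z.1 z.2 ^+ 2)%:E)%E.
  rewrite -ge0_integralZl_EFin//; last by rewrite mulr_ge0.
  have -> : ((w ^+ 2)%:E = \int[Pi]_z (cst (w ^+ 2)%:E z))%E.
    by rewrite integral_cst// [X in (_ * X)%E](_ : _ = 1%E) ?mule1//; exact: probability_setT.
  rewrite -ge0_integralD//; last 2 first.
  - by move=> z _; rewrite lee_fin sqr_ge0.
  - by move=> z _; rewrite lee_fin sqr_ge0.
  apply: ge0_le_integral => //.
  - by move=> z _; rewrite -EFinM lee_fin; apply: mulr_ge0; [exact: mulr_ge0|exact: circle_dist_ge0].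
  - exact: measurable_funeM.
  - exact: emeasurable_funD.
  - move=> z _; rewrite /= -EFinM -EFinD lee_fin.
    exact: mul2_le_sqr.
move: key young; rewrite -(fineK I1fin) -(fineK I2fin) -!EFinM -EFinD !lee_fin.
move: (fine _) (fine _) => I2 I1 key young.
have wI : w <= I1 by rewrite /w ler_pdivrMr// [leRHS]mulrC.
have : w * w <= w * I1 by rewrite ler_wpM2l.
by rewrite -expr2; lra.
Qed.

End WassersteinLowerBound.

(** * Auxiliary estimates for the assembly *)

Section Assembly.
Variable R : realType.
Implicit Types (s t x y c : R) (nu mu : probability (circle R) R) (G H : R -> R) (n k : nat).

(** Each full turn adds 1 to G, which suffices because c <= 1. *)
Lemma slope_extend G c : (forall s, G (s + 1) = G s + 1) -> 0 < c -> c <= 1 ->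
  (forall s t, s <= t < s + 1 -> c * (t - s) <= G t - G s) ->
  forall s t, s <= t -> c * (t - s) <= G t - G s.
Proof.
move=> GD c0 c1 loc s t st.
have GDn m x : G (x + m%:R) = G x + m%:R.
  by elim: m => [|m IH]; rewrite ?addr0// -natr1 addrA GD IH -addrA.
have m0 : 0 <= t - s by rewrite subr_ge0.
have := truncn_itv m0; set m := Num.truncn _; rewrite -natr1 => mt.
have tE : t = t - m%:R + m%:R by rewrite subrK.
rewrite {2}tE GDn; have := loc s (t - m%:R) _.
have cm : c * m%:R <= 1 * m%:R by rewrite ler_wpM2r.
by rewrite mul1r in cm; move=> /(_ ltac:(lra)); lra.
Qed.

Lemma lipschitz_continuous G c : 0 < c ->
  (forall s t, `|G s - G t| <= c * `|s - t|) -> continuous G.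
Proof.
move=> c0 Gc s; apply/cvgrPdist_lt => e e0; near=> t.
apply: (le_lt_trans (Gc s t)); rewrite mulrC -ltr_pdivlMr//.
by near: t; apply: (@nbhsx_ballx R R s (e / c)); rewrite divr_gt0.
Unshelve. all: by end_near. Qed.

Lemma degmap_perturb G H c : 0 < c -> continuous G -> (forall s, G (s + 1) = G s + 1) ->
  (forall s t, s <= t -> c * (t - s) <= G t - G s) ->
  (forall s, H (s + 1) = H s) -> (forall s t, `|H s - H t| <= c / 2 * `|s - t|) ->
  degmap (fun s => G s - H s) 1 /\
  (forall s t, s <= t -> c / 2 * (t - s) <= (G t - H t) - (G s - H s)).
Proof.
move=> c0 Gc GD Gs HD HL; have c20 : 0 < c / 2 by lra.
have slope s t : s <= t -> c / 2 * (t - s) <= (G t - H t) - (G s - H s).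
  move=> st; have := Gs s t st; have := HL t s.
  rewrite (ger0_norm (_ : 0 <= t - s)) ?subr_ge0//.
  by rewrite ler_norml => /andP[_]; lra.
split => //; split.
- by move=> s; apply: continuousB; [exact: Gc|exact: (lipschitz_continuous c20 HL)].
- apply: homo_lt_mono_le => s t st; rewrite -subr_gt0.
  by apply: lt_le_trans (slope _ _ (ltW st)); rewrite mulr_gt0// subr_gt0.
- by move=> s; rewrite GD HD addrAC.
Qed.

Lemma enorm_coord n (a : 'rV[R]_n) (i : 'I_n) : `|a ord0 i| <= enorm a.
Proof.
rewrite -sqrtr_sqr /enorm ler_wsqrtr// (bigD1 i)//= lerDl.
by apply: sumr_ge0 => j _; exact: sqr_ge0.
Qed.

Lemma enorm_ge0 n (a : 'rV[R]_n) : 0 <= enorm a.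
Proof. exact: sqrtr_ge0. Qed.

Lemma sum_coord_le n (a : 'rV[R]_n) : \sum_(i < n) `|a ord0 i| <= n%:R * enorm a.
Proof.
apply: (@le_trans _ _ (\sum_(i < n) enorm a)); last first.
  by rewrite sumr_const card_ord mulr_natl.
by apply: ler_sum => i _; exact: enorm_coord.
Qed.

Lemma enorm_le n (a : 'rV[R]_n) c : (0 < n)%N -> 0 <= c ->
  (forall i, `|a ord0 i| <= c) -> enorm a <= n%:R * c.
Proof.
move=> n0 c0 ac; have n1 : 1 <= n%:R :> R by rewrite ler1n.
have nc : 0 <= n%:R * c by rewrite mulr_ge0.
rewrite /enorm -[leRHS](ger0_norm nc) -sqrtr_sqr ler_wsqrtr//.
apply: (@le_trans _ _ (\sum_(i < n) c ^+ 2)).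
  by apply: ler_sum => i _; rewrite -[_ ^+ 2]real_normK ?num_real// lerXn2r ?nnegrE.
rewrite sumr_const card_ord -(mulr_natl (c ^+ 2)) exprMn ler_wpM2r ?sqr_ge0//.
by rewrite expr2 ler_peMr.
Qed.

Lemma enorm_max n (a : 'rV[R]_n) : (0 < n)%N ->
  exists i, enorm a <= n%:R * `|a ord0 i|.
Proof.
move=> n0; have [i _ hi] := @arg_maxP _ _ _ (Ordinal n0) xpredT (fun i => `|a ord0 i|) isT.
by exists i; apply: enorm_le => // j; exact: hi.
Qed.

Lemma natz_le_abs (k : nat) (K : int) : k%:Z <= K -> (k <= `|K|)%N.
Proof. by lia. Qed.

Lemma invariant_iter (Phi : expanding_map R) mu k (A : set (circle R)) :
  measure_eq (push Phi mu) mu -> measurable A -> mu (iter k Phi @^-1` A) = mu A.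
Proof.
move=> inv; elim: k A => [|k IH] A mA //.
have mPA : measurable (Phi @^-1` A).
  by rewrite -[X in measurable X]setTI; exact: (@expanding_measurable _ Phi).
rewrite -(inv A mA) -[RHS]/(mu (Phi @^-1` A)) -(IH _ mPA).
by [].
Qed.

Lemma acip_cdf (Phi : expanding_map R) mu : mu `<< circle_lebesgue R ->
  measure_eq (push Phi mu) mu ->
  exists G c, [/\ lcdf mu G, continuous G, (forall s, G (s + 1) = G s + 1), 0 < c &
    forall s t, s <= t -> c * (t - s) <= G t - G s].
Proof.
move=> mul inv; have /null_content_dominatesP mul' := mul.
have at0 (x : circle R) : mu [set x] = 0%E.
  by apply: mul'; [exact: measurable_circle1|exact: circle_lebesgue_atomless].
have muG := atomless_lcdf at0; set G := (fun t => _ + _) in muG.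
have [f [p [sg [d [La [D [B [fPhi sgE fE d1 pL]]]]]]]] := expanding_liftP (expanding_funP Phi).
have [_ La1 _ B0 _] := pL.
have E1 : 1 <= expR (B / (La - 1)).
  by rewrite -{1}expR0 ler_expR divr_ge0//; lra.
have E0 : 0 < expR (B / (La - 1)) by exact: expR_gt0.
exists G, (expR (B / (La - 1)))^-1; split => //.
- exact: lcdf_continuous muG.
- by move=> s; exact: lcdfD1 muG.
- by rewrite invr_gt0.
apply: slope_extend; rewrite ?invr_gt0 ?invf_le1//.
  by move=> s; exact: lcdfD1 muG.
move=> s t st; rewrite ler_pdivrMl//.
apply: (invariant_slope fPhi sgE fE (ltnW d1) pL mul _ muG st).
by move=> k A mA; exact: invariant_iter.
Qed.

End Assembly.

(** * The perturbed distribution functions *)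

Section MainEstimates.
Variables (R : realType) (Phi : expanding_map R) (mu : probability (circle R) R).
Variables (f p g G : R -> R) (sg D c : R) (d n : nat).
Hypotheses (inv : measure_eq (push Phi mu) mu) (muG : lcdf mu G) (Gc : continuous G)
  (GD : forall s, G (s + 1) = G s + 1) (c0 : 0 < c)
  (Gs : forall s t, s <= t -> c * (t - s) <= G t - G s).
Hypotheses (fPhi : is_lift f Phi) (sgE : sg = 1 \/ sg = -1)
  (fE : forall u, f u = sg * p u) (d1 : (1 < d)%N) (pd : degmap p d)
  (pg : cancel p g) (gp : cancel g p)
  (D1 : 1 <= D) (pD : forall s t, `|p s - p t| <= D * `|s - t|) (n0 : (0 < n)%N).
Implicit Types (s t x y e : R) (a b : 'rV[R]_n) (nu : probability (circle R) R).

(** Chosen so that [theta_lip] gives the Lipschitz constant c / 2, half of the slope guaranteed for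
    G. *)
Definition amplitude : R := c / (32 * D * n%:R).

Let D0 : 0 < D. Proof. exact: lt_le_trans D1. Qed.
Let nR0 : 0 < n%:R :> R. Proof. by rewrite ltr0n. Qed.

Lemma amplitude_gt0 : 0 < amplitude.
Proof. by rewrite divr_gt0// !mulr_gt0. Qed.

Definition thetaA := @theta R f p sg D d n amplitude.

Lemma thetaA_lip j N a x y : `|thetaA j N a x - thetaA j N a y| <= c / 2 * `|x - y|.
Proof.
have := theta_lip sgE fE d1 D1 pD j N a x y (ltW amplitude_gt0).
move/le_trans; apply; rewrite le_eqVlt; apply/orP; left; apply/eqP; congr (_ * _).
by rewrite /amplitude; field; rewrite !gt_eqF.
Qed.

Lemma thetaA_period j N a s : thetaA j N a (s + 1) = thetaA j N a s.
Proof.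
rewrite /thetaA /theta; congr (_ * _); apply: eq_bigr => i _; apply: eq_bigr => k _.
by congr (_ * _); exact: (wave_iterDz fPhi d1 pd i k s 1).
Qed.

Definition perturbed j N a s := G s - thetaA j N a s.

Lemma perturbed_degmap j N a : degmap (perturbed j N a) 1.
Proof.
by have [] := degmap_perturb c0 Gc GD Gs (thetaA_period j N a) (thetaA_lip j N a).
Qed.

Lemma perturbed_slope j N a s t : s <= t ->
  c / 2 * (t - s) <= perturbed j N a t - perturbed j N a s.
Proof.
by have [_] := degmap_perturb c0 Gc GD Gs (thetaA_period j N a) (thetaA_lip j N a); exact.
Qed.

(** Each push-forward consumes one term of the sum, hence the hypothesis for all large lengths N:
    length N after a step comes from length N + 1 before it. *)
Lemma lcdf_iter_push nu N0 a : (forall N, (N0 <= N)%N -> lcdf nu (perturbed 0 N a)) ->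
  forall j N, (N0 <= N)%N -> lcdf (iter j (push Phi) nu) (perturbed j N a).
Proof.
have gm : {mono g : s t / s <= t} by have [_ pm _] := pd; move=> s t; rewrite -pm !gp.
have gD t (m : int) : g (t + m%:~R * d%:R) = g t + m%:~R.
  by rewrite -[LHS]pg -[in RHS](pg (g t + _)) (degmapDz _ _ pd) !gp.
have d0 := ltnW d1.
move=> nuP; elim=> [|j IH] N NN; first exact: nuP.
move=> s t st; rewrite iterS.
rewrite -[LHS]/(iter j (push Phi) nu (Phi @^-1` carc s t)).
have IH' := IH N.+1 (leqW NN).
rewrite (lcdf_transfer d0 pd pg gp gm gD sgE fE fPhi IH' st).
(* By invariance, [G] and its transfer are lifted distribution functions of the same measure; only
   their increments need to agree. *)
have trG : transfer sg g d G t - transfer sg g d G s = G t - G s.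
  apply/eqP; rewrite -eqe -muG//.
  rewrite -(lcdf_transfer d0 pd pg gp gm gD sgE fE fPhi muG st) eq_sym; apply/eqP.
  by apply/esym/inv; exact: measurable_carc.
have trP u : transfer sg g d (perturbed j N.+1 a) u =
    transfer sg g d G u - thetaA j.+1 N a u.
  rewrite /thetaA -(transfer_theta D fPhi sgE fE d1 pd gp).
  by rewrite /transfer /perturbed sumrB mulrBr.
by rewrite !trP /perturbed; congr EFin; lra.
Qed.

Lemma W_perturbed nu nu' j k N a b e : 0 <= e -> lcdf nu (perturbed j N a) -> lcdf nu' (perturbed k N b) ->
  (forall s, `|thetaA j N a s - thetaA k N b s| <= e) ->
  coupling nu nu' !=set0 /\ W nu nu' <= e / (c / 2).
Proof.
move=> e0 nuP nuP' ab; have c2 : 0 < c / 2 by rewrite divr_gt0.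
have [|Pi cPi PiP] := lcdf_coupling (e := e) (perturbed_degmap j N a)
    (perturbed_degmap k N b) nuP nuP' c2 (fun s t => @perturbed_slope j N a s t).
  move=> t; rewrite /perturbed opprB addrC addrA subrK distrC.
  exact: ab.
split; first by exists Pi.
by apply: W_le; [rewrite divr_ge0// ltW|exists Pi].
Qed.

(** For y within half a tent width of node i, the arc masses differ by 2 [amplitude] |a_i - b_i|
    times a tent value of at least half the radius. This window of y has length [tent_radius] times
    d. *)
Lemma W_perturbed_ge nu nu' N a b i : (0 < N)%N ->
  (forall i, `|a ord0 i| <= 1) -> (forall i, `|b ord0 i| <= 1) ->
  lcdf nu (perturbed 0 N a) -> lcdf nu' (perturbed 0 N b) ->
  coupling nu nu' !=set0 ->
  amplitude * tent_radius R n d * `|a ord0 i - b ord0 i| * (tent_radius R n d * d%:R) / D <= W nu nu'.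
Proof.
move=> N0 a1 b1 nuP nuP' cn; have d0 := ltnW d1.
have dR0 : 0 < d%:R :> R by rewrite ltr0n.
have n1 : 0 < n.+1%:R :> R by rewrite ltr0n.
have ni : 0 < n.+1%:R^-1 :> R by rewrite invr_gt0.
have rd : tent_radius R n d * d%:R = n.+1%:R^-1 / 2.
  by rewrite /tent_radius; field; rewrite ?gt_eqF.
have node_in := tent_node_itv R (ltn_ord i).
set w := tent_radius R n d * d%:R / 2.
have wE : w = n.+1%:R^-1 / 4 by rewrite /w rd; move: (n.+1%:R^-1) => z; lra.
have ab : 0 <= tent_node R n i - w < tent_node R n i + w.
  by move: node_in; rewrite wE; move: (n.+1%:R^-1) ni (tent_node _ _ _) => z z0 x; lra.
have ab1 : tent_node R n i + w <= 1.
  by move: node_in; rewrite wE; move: (n.+1%:R^-1) ni (tent_node _ _ _) => z z0 x; lra.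
have e0 : 0 <= amplitude * tent_radius R n d * `|a ord0 i - b ord0 i|.
  apply: mulr_ge0 => //; apply: mulr_ge0; apply: ltW.
    exact: amplitude_gt0.
  exact: tent_radius_gt0.
rewrite (_ : tent_radius R n d * d%:R = tent_node R n i + w - (tent_node R n i - w)); last first.
  by rewrite /w; lra.
apply: (W_ge_branch d1 pd pg gp D0 pD ab ab1 e0 cn) => y yab.
have y01 : 0 < y < 1 by move: yab ab ab1; lra.
have width := branch_width y d1 pd pg gp.
exists (perturbed 0 N a (g (y + 1)) - perturbed 0 N a (g y)).
exists (perturbed 0 N b (g (y + 1)) - perturbed 0 N b (g y)).
split; [exact: nuP|exact: nuP'|].
have ta := theta_branch D fPhi sgE fE d1 pd gp amplitude N0 y01 a1.
have tb := theta_branch D fPhi sgE fE d1 pd gp amplitude N0 y01 b1.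
have yi : `|y - tent_node R n i| <= tent_radius R n d * d%:R / 2.
  by rewrite -/w ler_norml; move: yab; lra.
have -> : perturbed 0 N a (g (y + 1)) - perturbed 0 N a (g y) -
    (perturbed 0 N b (g (y + 1)) - perturbed 0 N b (g y)) =
    2 * amplitude * ((a ord0 i - b ord0 i) * tent n d i y).
  have tE : forall z : 'rV[R]_n, \sum_(l < n) z ord0 l * tent n d l y = z ord0 i * tent n d i y.
    move=> z; rewrite (bigD1 i)//= big1 ?addr0// => l li.
    by rewrite (tent_far d1 y01 (ltn_ord i) (ltn_ord l) _ yi) ?mulr0//.
  move: ta tb; rewrite !tE /perturbed /thetaA => ta tb.
  rewrite mulrBl mulrBr.
  by move: ta tb; rewrite /thetaA; lra.
have tn := tent_near d1 y01 (ltn_ord i) yi; have A0 := amplitude_gt0.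
have t0 := tent_ge0 n d i y.
rewrite normrM (normrM (_ - _)) (ger0_norm t0) (ger0_norm (mulr_ge0 (ler0n R 2) (ltW A0))).
move: (normr_ge0 (a ord0 i - b ord0 i)) tn t0 A0.
move: (tent _ _ _ _) (tent_radius _ _ _) (`|a ord0 i - b ord0 i|) amplitude => u r z A z0 ru u0 A0.
have : A * z * (r / 2) <= A * z * u by rewrite ler_wpM2l// mulr_ge0// ltW.
by lra.
Qed.

End MainEstimates.

(* F is only meaningful on the closed unit ball.  Measures are compared by
   measure_eq, i.e. on Borel sets: a library measure is a function on all sets,
   with unconstrained values outside the sigma-algebra. *)
Theorem theorem1p4 (R : realType) (Phi : expanding_map R)
    (rho_lambda : probability (circle R) R)
    (rho_lambda_ac : rho_lambda `<< circle_lebesgue R)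
    (rho_lambda_inv : measure_eq (push Phi rho_lambda) rho_lambda)
    (n : nat) (n_gt0 : (0 < n)%N) :
  exists F : 'rV[R]_n -> probability (circle R) R,
  [/\ bilipschitz_on (eball n 1) F,
      measure_eq (F 0) rho_lambda,
      (fun a : 'rV[R]_n => W (push Phi (F a)) (F a)) =o_ (0 : 'rV[R]_n)
        (@enorm R n)
    & forall (eps : R) (K : int), 0 < eps ->
      exists2 r : R, 0 < r <= 1 &
        forall (k : nat) (a : 'rV[R]_n), k%:Z <= K -> eball n r a ->
          W (iter k (push Phi) (F a)) (F a) <= eps * enorm a].
Proof.
have [G [c [muG Gc GD c0 Gs]]] := acip_cdf rho_lambda_ac rho_lambda_inv.
have [f [p [sg [d [La [D [B [fPhi sgE fE d1 pL]]]]]]]] := expanding_liftP (expanding_funP Phi).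
have [pd La1 pbd _ _] := pL; have d0 := ltnW d1; have [_ pm _] := pd.
have D1 : 1 <= D by have /andP[] := pbd 0 1 ler01; lra.
have pD s t : `|p s - p t| <= D * `|s - t|.
  wlog ts : s t / t <= s.
    by move=> h; have [|/ltW] := leP t s; [|rewrite distrC (distrC s)]; exact: h.
  have /andP[_ h] := pbd t s ts.
  by rewrite !ger0_norm ?subr_ge0 ?pm.
have [g [pg gp _ _ _]] := degmap_inv d0 pd.
pose P := @perturbed R f p G sg D c d n.
(* [N0 a] terms already give the whole series at [a], so [F a] comes from a finite sum, and two
   parameters are compared at a common larger length. *)
have /choice[N0 N0P] := @theta_stable R f p sg D d n D1.
have /choice[F FP] : forall a : 'rV[R]_n, exists nu, lcdf nu (P 0 (N0 a) a).
  move=> a; apply: lcdf_exists.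
  exact: (perturbed_degmap Gc GD c0 Gs fPhi sgE fE d1 pd D1 pD n_gt0).
have FN a N : (N0 a <= N)%N -> lcdf (F a) (P 0 N a).
  move=> NN; suff -> : P 0 N a = P 0 (N0 a) a by exact: FP.
  by apply/funext => s; rewrite /P /perturbed /thetaA N0P.
set A := @amplitude R D c n.
have A0 : 0 < A by exact: amplitude_gt0.
have nR0 : 0 < n%:R :> R by rewrite ltr0n.
have sub_coord (a b : 'rV[R]_n) i : a ord0 i - b ord0 i = (a - b) ord0 i by rewrite !mxE.
have coupled j k N a b e := W_perturbed Gc GD c0 Gs fPhi sgE fE d1 pd D1 pD n_gt0
  (j := j) (k := k) (N := N) (a := a) (b := b) (e := e).
have upper a b : coupling (F a) (F b) !=set0 /\ W (F a) (F b) <= 12 * A * n%:R / c * enorm (a - b).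
  pose N := maxn (N0 a) (N0 b).
  have Fa := FN a N (leq_maxl _ _); have Fb := FN b N (leq_maxr _ _).
  have e0 : 0 <= A * (6 * (n%:R * enorm (a - b))).
    by rewrite (mulr_ge0 (ltW A0))// mulr_ge0// mulr_ge0// enorm_ge0.
  have [|cn le_e] := coupled (F a) (F b) 0%N 0%N N a b _ e0 Fa Fb.
    move=> s; rewrite /thetaA; apply: (le_trans (theta_sub_le f p D sgE d1 _ _ _ _ _ (ltW A0))).
    apply: ler_wpM2l; [exact: ltW|apply: ler_wpM2l => //].
    by under eq_bigr do rewrite sub_coord; exact: sum_coord_le.
  split => //; apply: (le_trans le_e); rewrite le_eqVlt; apply/orP; left; apply/eqP.
  by field; rewrite gt_eqF.
have ball1 (a : 'rV[R]_n) i : eball n 1 a -> `|a ord0 i| <= 1.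
  by move=> ha; apply: le_trans (enorm_coord a i) ha.
pose r := tent_radius R n d.
have r0 : 0 < r by exact: tent_radius_gt0.
have dR0 : 0 < d%:R :> R by rewrite ltr0n.
have DR0 : 0 < D by lra.
pose C2 := A * r * (r * d%:R) / D / n%:R.
have C20 : 0 < C2.
  by do 2 apply: divr_gt0 => //; apply: mulr_gt0; exact: mulr_gt0.
have lower a b : eball n 1 a -> eball n 1 b -> C2 * enorm (a - b) <= W (F a) (F b).
  move=> ha hb; have [i hi] := enorm_max (a - b) n_gt0.
  (* The successor guarantees that the term k = 0, which carries the lower bound, is present. *)
  pose N := (maxn (N0 a) (N0 b)).+1.
  have Fa : lcdf (F a) (P 0 N a) by apply: FN; rewrite leqW// leq_maxl.
  have Fb : lcdf (F b) (P 0 N b) by apply: FN; rewrite leqW// leq_maxr.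
  have := W_perturbed_ge c0 fPhi sgE fE d1 pd pg gp D1 pD n_gt0 i (ltn0Sn _)
    (fun l => ball1 a l ha) (fun l => ball1 b l hb) Fa Fb (upper a b).1.
  apply: le_trans; rewrite sub_coord -/A -/r.
  apply: (@le_trans _ _ (C2 * (n%:R * `|(a - b) ord0 i|))); first by apply: ler_wpM2l => //; exact: ltW.
  rewrite le_eqVlt; apply/orP; left; apply/eqP; rewrite /C2.
  by move: (`|_ ord0 i|) => z; field; rewrite !gt_eqF.
(* This one estimate serves both asymptotic claims; the little-o is the case k = 1. *)
have small (eps : R) (K : nat) : 0 < eps -> exists2 rad : R, 0 < rad <= 1 &
    forall (k : nat) (a : 'rV[R]_n), (k <= K)%N -> enorm a <= rad ->
      W (iter k (push Phi) (F a)) (F a) <= eps * enorm a.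
  (* The tail 2^-M enters W with the factor 6 A n from the sup norm estimate, divided by the slope c
     / 2. *)
  move=> eps0; have [M hM] := exprn_unbounded (12 * A * n%:R / c / eps) (ltr1n R 2).
  have sc0 k := scale_gt0 D1 k.
  (* On this ball the terms of index at most M escape the cut-off, before and after a shift by k <=
     K. *)
  exists (scale D (M + K)).
    rewrite sc0/= -[leRHS](_ : scale D 0 = 1); last by rewrite /scale expr0 invr1.
    exact: scale_le.
  move=> k a kK ha; pose N := N0 a.
  have Fk := lcdf_iter_push rho_lambda_inv muG fPhi sgE fE d1 pd pg gp (FN a) k (leqnn N).
  have e0 : 0 <= A * (6 * 2^-1 ^+ M * (n%:R * enorm a)).
    by rewrite (mulr_ge0 (ltW A0))// mulr_ge0// mulr_ge0// enorm_ge0.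
  have [|_ le_e] := coupled _ (F a) k 0%N N a a _ e0 Fk (FN a N (leqnn N)).
    move=> s; rewrite distrC.
    apply: (le_trans (theta_shift_le f p sgE d1 D1 (M := M) N s (ltW A0) _)).
      move=> i; apply: (le_trans (enorm_coord a i)); apply: (le_trans ha).
      by apply: scale_le => //; rewrite leq_add2l.
    apply: ler_wpM2l; first exact: ltW.
    apply: ler_wpM2l; first by rewrite mulr_ge0// exprn_ge0// invr_ge0.
    exact: sum_coord_le.
  apply: (le_trans le_e).
  rewrite [leLHS](_ : _ = 12 * A * n%:R / c * 2^-1 ^+ M * enorm a); last first.
    by move: (2^-1 ^+ M) => z; field; rewrite gt_eqF.
  rewrite ler_wpM2r ?enorm_ge0// exprVn ler_pdivrMr ?exprn_gt0//.
  by move: hM; rewrite ltr_pdivrMr// [ltRHS]mulrC => /ltW.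
exists F; split.
- have C10 : 0 <= 12 * A * n%:R / c.
    by apply/ltW/divr_gt0 => //; apply: mulr_gt0 => //; exact: mulr_gt0.
  have C2i : 0 < C2^-1 by rewrite invr_gt0.
  exists (12 * A * n%:R / c + C2^-1); first by rewrite ltr_wpDl.
  move=> a b ha hb; apply/andP; split.
    apply: le_trans (lower a b ha hb); rewrite ler_wpM2r ?enorm_ge0//.
    by rewrite -[leRHS]invrK lef_pV2 ?posrE ?lerDr// ltr_wpDl.
  by apply: (le_trans (upper a b).2); rewrite ler_wpM2r ?enorm_ge0// lerDl ltW.
- move=> S mS; apply: (lcdf_unique (FP 0) _ mS).
  apply: (@lcdf_shift _ _ _ G 0) muG => t; rewrite addr0 /P /perturbed /thetaA /theta.
  rewrite big1 ?mulr0 ?subr0// => i _; apply: big1 => k _.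
  by rewrite mxE cutoff0 ?mul0r ?ltW ?scale_gt0.
- apply/eqoP => eps eps0; have [rad /andP[rad0 _] hr] := small eps 1%N eps0.
  (* Neighbourhoods are taken in the sup norm, which controls the Euclidean norm up to the factor
     n. *)
  apply/nbhs_ballP; exists (rad / n%:R) => /=; first by rewrite divr_gt0.
  move=> a /= ha; rewrite !ger0_norm ?enorm_ge0 ?sqrtr_ge0//.
  apply: (hr 1%N) => //; rewrite -[rad](divfK (lt0r_neq0 nR0)) mulrC.
  apply: enorm_le => //; first by rewrite divr_ge0 ?ltW.
  move=> i; have [_ h] : @mx_ball _ _ _ _ 0 (rad / n%:R) a := ha.
  by have := h ord0 i; rewrite /ball/= mxE sub0r normrN; exact: ltW.
- move=> eps K eps0; have [rad rad01 hr] := small eps `|K|%N eps0.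
  by exists rad => // k a /natz_le_abs kK ha; exact: hr.
Qed.
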